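(* Let $u:\mathbb R\times(0,\infty)\to\mathbb R$ be twice continuously differentiable in $x$ and continuously differentiable in $t$, with $\partial_tu-\partial_x^2u=0$ on $\mathbb R\times(0,\infty)$. Suppose $u(\cdot,t)\in\mathcal A_c$ for each $t>0$, $\|u(\cdot,t)\|$ is bounded for $t\in(0,\infty)$, and $\lim_{t\to0^+}\|u(\cdot,t)-f\|=0$ for some $f\in\mathcal A_c$. Then $u(x,t)=f\ast\Theta_t(x)$ for all $(x,t)\in\mathbb R\times(0,\infty)$; i.e., $f\ast\Theta_t$ is the unique solution with these properties.
   Context: Let $\mathcal B_c$ be the set of continuous $F:\mathbb R\to\mathbb R$ such that $\lim_{x\to\pm\infty}F(x)$ exist as real numbers and $\lim_{x\to-\infty}F(x)=0$. $\mathcal A_c$ is the set of distributions $f=F'$ (distributional derivative) with $F\in\mathcal B_c$ (unique primitive); integral $\int_a^bf=F(b)-F(a)$; Alexiewicz norm $\|f\|=\sup_{x<y}|F(y)-F(x)|$. For $h$ of bounded variation, $\int_{-\infty}^\infty fh:=F(\infty)h(\infty)-\int F\,dh$ (Henstock–Stieltjes), and $f\ast h(x)=\int_{-\infty}^\infty f(\xi)h(x-\xi)\,d\xi$ in this sense. $\Theta_t(x)=(4\pi t)^{-1/2}e^{-x^2/(4t)}$, $t>0$. *)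

(* Defs.v *)
From Stdlib Require Import Reals.
From Coquelicot Require Import Coquelicot.
Open Scope R_scope.

Definition in_Bc (F : R -> R) : Prop :=
  (forall x, continuous F x) /\
  is_lim F m_infty 0 /\
  (exists L : R, is_lim F p_infty L).

Definition smooth (phi : R -> R) : Prop := forall n x, ex_derive_n phi n x.
Definition supported_in (phi : R -> R) (a b : R) : Prop :=
  forall x, x < a \/ b < x -> phi x = 0.
Definition test_fun (phi : R -> R) : Prop :=
  smooth phi /\ exists a b, supported_in phi a b.

(* The distributional derivative of the (continuous) function F is the
   regular distribution given by the locally integrable function g:
   <F', phi> = - <F, phi'> = <g, phi> for all test functions phi. *)
Definition dist_deriv (F g : R -> R) : Prop :=
  forall phi, test_fun phi -> forall a b, a <= b -> supported_in phi a b ->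
    - RInt (fun x => F x * Derive phi x) a b = RInt (fun x => g x * phi x) a b.

(* F is the (unique) B_c-primitive of the distribution g, i.e. g = F' in A_c. *)
Definition Ac_primitive (g F : R -> R) : Prop := in_Bc F /\ dist_deriv F g.

(* Alexiewicz norm of f = F' in A_c, given through its primitive F:
   sup_{x<y} |F y - F x| (an element of Rbar; finite for F in B_c). *)
Definition alex_norm (F : R -> R) : Rbar :=
  Lub_Rbar (fun r => exists x y, x < y /\ r = Rabs (F y - F x)).

Definition Theta (t x : R) : R := / sqrt (4 * PI * t) * exp (- x ^ 2 / (4 * t)).

(* int_{-oo}^{oo} f h := F(oo) h(oo) - int F dh, for f = F'.  The integrators
   h used here are C^1 with integrable derivative, for which the
   Henstock--Stieltjes integral int F dh equals int F(x) h'(x) dx. *)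
Definition pair_Ac (F h : R -> R) : R :=
  real (Lim F p_infty) * real (Lim h p_infty)
  - RInt_gen (fun x => F x * Derive h x) (Rbar_locally m_infty) (Rbar_locally p_infty).

Definition conv_Theta (F : R -> R) (t x : R) : R :=
  pair_Ac F (fun xi => Theta t (x - xi)).

(* Main.v *)
Require Import Defs.
From Stdlib Require Import Reals.
From Coquelicot Require Import Coquelicot.
From Stdlib Require Import Lra Lia.
Open Scope R_scope.

(** Centre the problem at [x] and pair the solution at time [s] with the backward
    heat kernel [Theta (T - s)], truncated by a smooth cutoff [chi] of radius [r].
    The derivative in [s] of this pairing only involves the commutator
    [2 Theta_z chi' + Theta chi''], which is again a test function; hence, by the
    definition of the distributional derivative, it can be estimated through the
    bounded primitives [U s].  Choosing [chi z = B (1 - (z / r) ^ 4)], the weights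
    [|z| ^ (k + 1)] coming from [chi] tame the [k]-th derivative of the kernel
    uniformly in time, so the derivative of the pairing is [O (1 / r ^ 3)].  As
    [s -> T] the pairing tends to the value of the solution; as [s -> 0] it tends
    to the pairing with [F], by uniform convergence of the primitives; letting
    [r] go to infinity gives the convolution formula. *)

(** * Smooth functions with compact support *)

(** Two constraints shape the argument. The distributional identity accepts only smooth compactly
    supported test functions, so the kernel must be cut off, and the products of kernel and cutoff
    must be certified smooth to all orders; the class [elem] does this once and for all. Moreover
    only the primitives are bounded, not the solution, so one more derivative falls on the
    commutator: it produces [Theta_zz * chi'], [Theta_z * chi''] and [Theta * chi'''], whose kernel
    factors blow up at the origin as the remaining time tends to 0. The exponent 4 comes from
    scaling. By self-similarity the [k]-th space derivative of the kernel is [|z| ^ -(k + 1)] times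
    a bounded function of [z ^ 2 / t], so a bound free of [t] needs [chi' = O(|z| ^ 3)],
    [chi'' = O(|z| ^ 2)] and [chi''' = O(|z|)], which is what [1 - z ^ 4] provides. Rescaling to
    radius [r] gives the factor [r ^ -4] in all three terms, and the interval of length [2 * r]
    leaves [r ^ -3]. *)

Lemma pow_mul_exp_neg_le (k : nat) (y : R) :
  0 <= y -> y ^ k * exp (- y) <= INR (Factorial.fact k).
Proof.
intros Hy.
assert (Hf : 0 < INR (Factorial.fact k)) by apply INR_fact_lt_0.
assert (H : y ^ k / INR (Factorial.fact k) <= exp y).
{ eapply Rle_trans; [| apply (exp_ge_taylor y k Hy)].
  assert (Hpos : forall j, 0 <= y ^ j / INR (Factorial.fact j)).
  { intros j. apply Rmult_le_pos; [apply pow_le; lra |].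
    left; apply Rinv_0_lt_compat, INR_fact_lt_0. }
  destruct k as [|k]; [apply Rle_refl | rewrite tech5].
  assert (0 <= sum_f_R0 (fun j => y ^ j / INR (Factorial.fact j)) k) by (apply cond_pos_sum; auto).
  lra. }
rewrite exp_Ropp.
assert (He := exp_pos y).
apply (Rmult_le_reg_r (exp y)); [lra |].
replace (y ^ k * / exp y * exp y) with (y ^ k) by (field; lra).
apply (Rmult_le_compat_l (INR (Factorial.fact k))) in H; [| lra].
replace (INR (Factorial.fact k) * (y ^ k / INR (Factorial.fact k))) with (y ^ k) in H by (field; lra).
exact H.
Qed.

(** Dividing by powers of [x] makes the family closed under differentiation up to linear
    combinations, so a single derivative formula yields smoothness of the classical flat function
    [flat 0]. *)
Definition flat (n : nat) (x : R) : R :=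
  if Rlt_dec 0 x then exp (- / x) / x ^ n else 0.

(** With [y = / x] this bounds [y ^ (n + 2) * exp (- y)] by a factorial, which holds because one
    Taylor term cannot exceed the exponential. The two spare powers of [x] force a zero derivative
    at the origin. *)
Lemma flat_bound (n : nat) (x : R) : Rabs (flat n x) <= INR (Factorial.fact (n + 2)) * x ^ 2.
Proof.
unfold flat; destruct (Rlt_dec 0 x) as [Hx|Hx].
- assert (Hy : 0 < / x) by (apply Rinv_0_lt_compat; lra).
  assert (H := pow_mul_exp_neg_le (n + 2) (/ x) (Rlt_le _ _ Hy)).
  assert (Hn : x ^ n <> 0) by (apply pow_nonzero; lra).
  rewrite Rabs_pos_eq.
  + apply (Rmult_le_compat_r (x ^ 2)) in H; [| apply pow2_ge_0].
    eapply Rle_trans; [right | exact H].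
    rewrite pow_inv, pow_add; field; split; [lra | exact Hn].
  + apply Rmult_le_pos; [left; apply exp_pos |].
    left; apply Rinv_0_lt_compat, pow_lt; lra.
- rewrite Rabs_R0; apply Rmult_le_pos; [apply pos_INR | apply pow2_ge_0].
Qed.

Lemma is_derive_flat (n : nat) (x : R) :
  is_derive (flat n) x (flat (n + 2) x - INR n * flat (n + 1) x).
Proof.
destruct (Rlt_dec 0 x) as [Hx|Hx]; [| destruct (Rlt_dec x 0) as [Hx'|Hx']].
- apply (is_derive_ext_loc (fun y => exp (- / y) / y ^ n)).
  + apply (filter_imp (fun y => 0 < y)); [| now apply open_gt].
    intros y Hy; unfold flat; destruct (Rlt_dec 0 y); [reflexivity | lra].
  + unfold flat; destruct (Rlt_dec 0 x); [| lra].
    assert (Hp : forall k, x ^ k <> 0) by (intros k; apply pow_nonzero; lra).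
    auto_derive; [repeat split; auto; lra |].
    rewrite !pow_add; destruct n as [|n].
    * simpl; field; lra.
    * simpl Init.Nat.pred; rewrite <- (tech_pow_Rmult x n).
      specialize (Hp n); simpl pow; field; split; auto; lra.
- assert (Hz : forall k, flat k x = 0)
    by (intros k; unfold flat; destruct (Rlt_dec 0 x); [lra | reflexivity]).
  rewrite !Hz.
  apply (is_derive_ext_loc (fun _ => 0)).
  + apply (filter_imp (fun y => y < 0)); [| now apply open_lt].
    intros y Hy; unfold flat; destruct (Rlt_dec 0 y); [lra | reflexivity].
  + replace (0 - INR n * 0) with 0 by ring. apply (is_derive_const (V := R_NormedModule) 0).
- assert (x = 0) by lra; subst x.
  assert (Hz : forall k, flat k 0 = 0)
    by (intros k; unfold flat; destruct (Rlt_dec 0 0); [lra | reflexivity]).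
  rewrite !Hz.
  replace (0 - INR n * 0) with 0 by ring.
  (* By [flat_bound] the difference quotient at the origin is at most [C * |h|], so [eps / C] serves
     as radius. *)
  apply is_derive_Reals; intros eps Heps.
  set (C := INR (Factorial.fact (n + 2))).
  assert (HC : 0 < C) by apply INR_fact_lt_0.
  assert (Hd : 0 < eps / C) by (apply Rdiv_lt_0_compat; lra).
  exists (mkposreal _ Hd); intros h Hh Hlt; simpl in Hlt.
  rewrite Hz, Rplus_0_l, !Rminus_0_r; unfold Rdiv.
  rewrite Rabs_mult, Rabs_inv.
  assert (Ha : 0 < Rabs h) by now apply Rabs_pos_lt.
  assert (Hb := flat_bound n h); fold C in Hb.
  rewrite <- (pow2_abs h) in Hb.
  apply (Rmult_lt_reg_r (Rabs h)); [exact Ha |].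
  rewrite Rmult_assoc, Rinv_l, Rmult_1_r by lra.
  eapply Rle_lt_trans; [exact Hb |].
  apply (Rmult_lt_compat_l C) in Hlt; [| lra].
  replace (C * (eps / C)) with eps in Hlt by (field; lra).
  nra.
Qed.

(* Closed under differentiation, whence every member is smooth. *)
Inductive elem : (R -> R) -> Prop :=
| elem_const c : elem (fun _ => c)
| elem_id : elem (fun x => x)
| elem_exp : elem exp
| elem_flat n : elem (flat n)
| elem_plus f g : elem f -> elem g -> elem (fun x => f x + g x)
| elem_mult f g : elem f -> elem g -> elem (fun x => f x * g x)
| elem_comp f g : elem f -> elem g -> elem (fun x => f (g x))
| elem_ext f g : (forall x, f x = g x) -> elem f -> elem g.

Lemma elem_derive (f : R -> R) :
  elem f -> exists f', elem f' /\ forall x, is_derive f x (f' x).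
Proof.
induction 1 as [c | | | n | f g Hf [f' [Hf1 Hf2]] Hg [g' [Hg1 Hg2]]
  | f g Hf [f' [Hf1 Hf2]] Hg [g' [Hg1 Hg2]]
  | f g Hf [f' [Hf1 Hf2]] Hg [g' [Hg1 Hg2]] | f g E Hf [f' [Hf1 Hf2]]].
- exists (fun _ => 0); split; [constructor | intros; apply (is_derive_const (V := R_NormedModule) c)].
- exists (fun _ => 1); split; [constructor | intros x; apply (is_derive_id (K := R_AbsRing) x)].
- exists exp; split; [constructor | intros x; apply is_derive_exp].
- exists (fun x => flat (n + 2) x + (- INR n) * flat (n + 1) x); split.
  + apply elem_plus; [apply elem_flat |].
    apply elem_mult; [apply elem_const | apply elem_flat].
  + intros x. replace (flat (n + 2) x + - INR n * flat (n + 1) x)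
      with (flat (n + 2) x - INR n * flat (n + 1) x) by ring.
    apply is_derive_flat.
- exists (fun x => f' x + g' x); split; [now apply elem_plus |].
  intros x; now apply (is_derive_plus f g).
- exists (fun x => f' x * g x + f x * g' x); split.
  + apply elem_plus; now apply elem_mult.
  + intros x; apply (is_derive_mult f g); auto. intros; apply Rmult_comm.
- exists (fun x => g' x * f' (g x)); split.
  + apply elem_mult; [assumption | now apply elem_comp].
  + intros x; now apply (is_derive_comp f g).
- exists f'; split; [assumption |].
  intros x; now apply (is_derive_ext f).
Qed.

Lemma elem_smooth (f : R -> R) : elem f -> smooth f.
Proof.
intros Hf.
assert (H : forall n, exists fn, elem fn /\ forall x, Derive_n f n x = fn x).
{ induction n as [|n [fn [H1 H2]]].
  - exists f; split; [assumption | reflexivity].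
  - destruct (elem_derive fn H1) as [f' [H3 H4]].
    exists f'; split; [assumption |].
    intros x; simpl; rewrite (Derive_ext _ _ _ H2).
    now apply is_derive_unique. }
intros [|n] x; [exact I |].
destruct (H n) as [fn [H1 H2]].
destruct (elem_derive fn H1) as [f' [H3 H4]].
simpl; apply (ex_derive_ext fn); [now intros |].
exists (f' x); apply H4.
Qed.

Lemma elem_continuous (f : R -> R) (x : R) : elem f -> continuous f x.
Proof.
intros Hf; destruct (elem_derive f Hf) as [f' [_ H]].
apply (ex_derive_continuous f); eexists; apply H.
Qed.

Lemma continuous_bounded (f : R -> R) (a b : R) :
  (forall x, a <= x <= b -> continuous f x) ->
  exists M, 0 <= M /\ forall x, a <= x <= b -> Rabs (f x) <= M.
Proof.
intros Hf; destruct (Rle_dec a b) as [Hab|Hab].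
- destruct (continuity_ab_maj (fun x => Rabs (f x)) a b Hab) as [m [Hm Hm']].
  + intros c Hc; apply (continuity_pt_comp f Rabs).
    * now apply continuity_pt_filterlim, Hf.
    * apply Rcontinuity_abs.
  + exists (Rabs (f m)); split; [apply Rabs_pos | exact Hm].
- exists 0; split; [lra | intros x Hx; lra].
Qed.

Lemma elem_bounded (f : R -> R) (a b : R) :
  elem f -> exists C, forall x, a <= x <= b -> Rabs (f x) <= C.
Proof.
intros Hf; destruct (continuous_bounded f a b) as [M [_ HM]].
- intros; now apply elem_continuous.
- now exists M.
Qed.

Lemma elem_pow (n : nat) : elem (fun x => x ^ n).
Proof.
induction n as [|n IH]; simpl; [apply elem_const |].
now apply (elem_mult (fun x => x)); [apply elem_id |].
Qed.

Lemma elem_scal (c : R) (f : R -> R) : elem f -> elem (fun x => c * f x).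
Proof. intros Hf; now apply (elem_mult (fun _ => c)); [apply elem_const |]. Qed.

Lemma supported_in_derive (f f' : R -> R) (a b : R) :
  supported_in f a b -> (forall x, is_derive f x (f' x)) -> supported_in f' a b.
Proof.
intros Hs Hd x Hx.
rewrite <- (is_derive_unique f x (f' x) (Hd x)).
rewrite <- (Derive_const 0 x).
apply Derive_ext_loc.
destruct Hx as [Hx|Hx].
- apply (filter_imp (fun y => y < a)); [intros; apply Hs; now left | now apply open_lt].
- apply (filter_imp (fun y => b < y)); [intros; apply Hs; now right | now apply open_gt].
Qed.

(** [supported_in] speaks only of points strictly outside the interval; continuity carries the
    vanishing to the endpoints, which later removes the boundary terms of integrations by parts. *)
Lemma supported_in_bounds (f : R -> R) (a b : R) :
  (forall x, continuous f x) -> supported_in f a b -> f a = 0 /\ f b = 0.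
Proof.
intros Hc Hs.
assert (H : forall c, (forall d : posreal, exists x, Rabs (x - c) < d /\ f x = 0) -> f c = 0).
{ intros c Hx.
  destruct (Req_dec (f c) 0) as [E|E]; [exact E | exfalso].
  assert (Hp : 0 < Rabs (f c)) by now apply Rabs_pos_lt.
  destruct (proj1 (filterlim_locally f (f c)) (Hc c) (mkposreal _ Hp)) as [d Hd].
  destruct (Hx d) as [x [Hx1 Hx2]].
  specialize (Hd x Hx1).
  change (Rabs (f x - f c) < Rabs (f c)) in Hd.
  rewrite Hx2, Rminus_0_l, Rabs_Ropp in Hd; lra. }
split; apply H; intros d; assert (Hd := cond_pos d).
- exists (a - d / 2); split; [| apply Hs; left; lra].
  replace (a - d / 2 - a) with (- (d / 2)) by ring.
  rewrite Rabs_Ropp, Rabs_pos_eq; lra.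
- exists (b + d / 2); split; [| apply Hs; right; lra].
  replace (b + d / 2 - b) with (d / 2) by ring.
  rewrite Rabs_pos_eq; lra.
Qed.

(* The profile is a flat function of [1 - z ^ 4]: the vanishing of its first
   derivatives at the origin compensates the blow-up of the heat kernel there. *)
Lemma unit_cutoff :
  exists (chi chi1 chi2 chi3 : R -> R) (C : R),
    (elem chi /\ elem chi1 /\ elem chi2 /\ elem chi3) /\
    (forall z, is_derive chi z (chi1 z)) /\
    (forall z, is_derive chi1 z (chi2 z)) /\
    (forall z, is_derive chi2 z (chi3 z)) /\
    supported_in chi (-1) 1 /\ chi 0 = 1 /\ 0 <= C /\
    (forall z, Rabs z <= 1 ->
       Rabs (chi1 z) <= C * Rabs z ^ 3 /\
       Rabs (chi2 z) <= C * Rabs z ^ 2 /\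
       Rabs (chi3 z) <= C * Rabs z).
Proof.
(* Since [flat 0 1 = exp (- 1)], the factor [exp 1] normalises the cutoff to 1 at the origin. *)
assert (HB : elem (fun x => exp 1 * flat 0 x)) by apply elem_scal, elem_flat.
destruct (elem_derive _ HB) as [B1 [E1 D1]].
destruct (elem_derive _ E1) as [B2 [E2 D2]].
destruct (elem_derive _ E2) as [B3 [E3 D3]].
set (B := fun x => exp 1 * flat 0 x) in *.
destruct (elem_bounded B1 0 1 E1) as [C1 HC1].
destruct (elem_bounded B2 0 1 E2) as [C2 HC2].
destruct (elem_bounded B3 0 1 E3) as [C3 HC3].
assert (Hw : elem (fun z => 1 - z ^ 4)).
{ apply (elem_ext (fun z => 1 + (-1) * z ^ 4)); [intros; ring |].
  apply elem_plus; [apply elem_const | apply elem_scal, elem_pow]. }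
assert (Hcomp : forall f, elem f -> elem (fun z => f (1 - z ^ 4)))
  by (intros f Hf; now apply (elem_comp f)).
assert (Hd : forall f f', (forall x, is_derive f x (f' x)) ->
  forall z, is_derive (fun z => f (1 - z ^ 4)) z (-4 * z ^ 3 * f' (1 - z ^ 4))).
{ intros f f' Hf z.
  assert (Hi : is_derive (fun z => 1 - z ^ 4) z (-4 * z ^ 3))
    by (auto_derive; [trivial | simpl; ring]).
  exact (is_derive_comp f (fun z => 1 - z ^ 4) z _ _ (Hf _) Hi). }
assert (Hm : forall (p p' f f' : R -> R), (forall x, is_derive p x (p' x)) ->
  (forall x, is_derive f x (f' x)) ->
  forall z, is_derive (fun z => p z * f (1 - z ^ 4)) z
    (p' z * f (1 - z ^ 4) + p z * (-4 * z ^ 3 * f' (1 - z ^ 4)))).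
{ intros p p' f f' Hp Hf z.
  apply (is_derive_mult p (fun z => f (1 - z ^ 4))); [apply Hp | now apply Hd |].
  intros; apply Rmult_comm. }
exists (fun z => B (1 - z ^ 4)).
exists (fun z => (-4 * z ^ 3) * B1 (1 - z ^ 4)).
exists (fun z => (-12 * z ^ 2) * B1 (1 - z ^ 4) + (16 * z ^ 6) * B2 (1 - z ^ 4)).
exists (fun z => ((-24 * z ^ 1) * B1 (1 - z ^ 4) + (144 * z ^ 5) * B2 (1 - z ^ 4))
  + (-64 * z ^ 9) * B3 (1 - z ^ 4)).
(* The sum of the absolute coefficients in the third derivative; it dominates the coefficient 4 of
   the first derivative and 12, 16 of the second. *)
exists (24 * C1 + 144 * C2 + 64 * C3).
assert (He : forall c k f, elem f -> elem (fun z => (c * z ^ k) * f (1 - z ^ 4))).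
{ intros c k f Hf; apply (elem_mult (fun z => c * z ^ k)); [| now apply Hcomp].
  apply elem_scal, elem_pow. }
assert (Hc1 := HC1 0 ltac:(lra)); assert (Hc2 := HC2 0 ltac:(lra)).
assert (Hc3 := HC3 0 ltac:(lra)).
assert (P1 := Rabs_pos (B1 0)); assert (P2 := Rabs_pos (B2 0)).
assert (P3 := Rabs_pos (B3 0)).
assert (Hterm : forall z c k l f D, Rabs z <= 1 -> (l <= k)%nat ->
  (forall x, 0 <= x <= 1 -> Rabs (f x) <= D) ->
  Rabs ((c * z ^ k) * f (1 - z ^ 4)) <= Rabs c * D * Rabs z ^ l).
{ intros z c k l f D Hz Hkl HD.
  assert (Hb : 0 <= 1 - z ^ 4 <= 1).
  { assert (z ^ 2 <= 1) by (rewrite <- (pow2_abs z); assert (K := Rabs_pos z); nra).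
    assert (0 <= z ^ 2) by apply pow2_ge_0.
    replace (z ^ 4) with (z ^ 2 * z ^ 2) by ring; nra. }
  specialize (HD _ Hb).
  rewrite !Rabs_mult, <- RPow_abs.
  replace k with (l + (k - l))%nat by lia.
  rewrite pow_add.
  assert (0 <= Rabs z ^ l) by apply pow_le, Rabs_pos.
  assert (0 <= Rabs z ^ (k - l)) by apply pow_le, Rabs_pos.
  assert (Rabs z ^ (k - l) <= 1).
  { rewrite <- (pow1 (k - l)); apply pow_incr; split; [apply Rabs_pos | assumption]. }
  rewrite (Rmult_assoc (Rabs c)), (Rmult_assoc (Rabs c)).
  apply Rmult_le_compat_l; [apply Rabs_pos |].
  rewrite Rmult_comm; apply Rmult_le_compat; auto using Rabs_pos; nra. }
split; [split; [| split; [| split]] |].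
- now apply Hcomp.
- auto.
- apply elem_plus; auto.
- apply elem_plus; [apply elem_plus |]; auto.
- split; [| split; [| split; [| split; [| split; [| split]]]]].
+ intros z; now apply Hd.
+ intros z.
  assert (Hp : forall x, is_derive (fun x => -4 * x ^ 3) x (-12 * x ^ 2))
    by (intros; auto_derive; [trivial | simpl; ring]).
  assert (H := Hm _ _ _ _ Hp D2 z).
  replace (16 * z ^ 6 * B2 (1 - z ^ 4)) with
    (-4 * z ^ 3 * (-4 * z ^ 3 * B2 (1 - z ^ 4))) by ring.
  exact H.
+ intros z.
  assert (Hp : forall x, is_derive (fun x => -12 * x ^ 2) x (-24 * x ^ 1))
    by (intros; auto_derive; [trivial | simpl; ring]).
  assert (Hq : forall x, is_derive (fun x => 16 * x ^ 6) x (96 * x ^ 5))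
    by (intros; auto_derive; [trivial | simpl; ring]).
  assert (H := is_derive_plus _ _ _ _ _ (Hm _ _ _ _ Hp D2 z) (Hm _ _ _ _ Hq D3 z)).
  unfold plus in H; simpl in H.
  match type of H with is_derive _ _ ?l => match goal with |- is_derive _ _ ?m =>
    replace m with l by (simpl; ring) end end.
  exact H.
+ intros x Hx; unfold B, flat; destruct (Rlt_dec 0 (1 - x ^ 4)) as [H|]; [exfalso | ring].
  assert (1 < x ^ 2) by (destruct Hx; nra).
  replace (x ^ 4) with (x ^ 2 * x ^ 2) in H by ring; nra.
+ unfold B, flat; replace (1 - 0 ^ 4) with 1 by ring.
  destruct (Rlt_dec 0 1) as [_|]; [| lra].
  replace (- / 1) with (-(1)) by field; rewrite exp_Ropp.
  assert (H := exp_pos 1); simpl; field; lra.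
+ lra.
+ intros z Hz.
  assert (Hz0 := Rabs_pos z).
  assert (0 <= Rabs z ^ 2) by (apply pow_le; lra).
  assert (0 <= Rabs z ^ 3) by (apply pow_le; lra).
  assert (Hn : forall q, 0 <= q -> 0 <= C1 * q /\ 0 <= C2 * q /\ 0 <= C3 * q).
  { intros q Hq; split; [| split]; apply Rmult_le_pos; lra. }
  destruct (Hn _ Hz0), (Hn (Rabs z ^ 2)), (Hn (Rabs z ^ 3)); auto.
  split; [| split].
  * eapply Rle_trans; [apply (Hterm z (-4) 3%nat 3%nat B1 C1); auto |].
    rewrite (Rabs_left (-4)) by lra; lra.
  * eapply Rle_trans; [apply Rabs_triang |].
    eapply Rle_trans; [apply Rplus_le_compat;
      [apply (Hterm z (-12) 2%nat 2%nat B1 C1) | apply (Hterm z 16 6%nat 2%nat B2 C2)]; auto; lia |].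
    rewrite (Rabs_left (-12)), (Rabs_pos_eq 16) by lra; lra.
  * eapply Rle_trans; [apply Rabs_triang |].
    eapply Rle_trans; [apply Rplus_le_compat; [eapply Rle_trans; [apply Rabs_triang |
      apply Rplus_le_compat; [apply (Hterm z (-24) 1%nat 1%nat B1 C1) |
        apply (Hterm z 144 5%nat 1%nat B2 C2)]] |
      apply (Hterm z (-64) 9%nat 1%nat B3 C3)]; auto; lia |].
    rewrite (Rabs_left (-24)), (Rabs_left (-64)), (Rabs_pos_eq 144) by lra; rewrite pow_1; lra.
Qed.

(** The weights on the three derivatives are reciprocal to the singularities of [Theta_zz],
    [Theta_z] and [Theta] that they multiply. The bound on [1 - chi] serves to remove the cutoff at
    the end. *)
Definition is_cutoff (r K : R) (chi chi1 chi2 chi3 : R -> R) : Prop :=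
  (elem chi /\ elem chi1 /\ elem chi2 /\ elem chi3) /\
  (forall z, is_derive chi z (chi1 z)) /\
  (forall z, is_derive chi1 z (chi2 z)) /\
  (forall z, is_derive chi2 z (chi3 z)) /\
  supported_in chi (- r) r /\ chi 0 = 1 /\
  (forall z, Rabs z <= r ->
     Rabs (1 - chi z) <= K * Rabs z ^ 4 /\
     Rabs (chi1 z) <= K * Rabs z ^ 3 /\
     Rabs (chi2 z) <= K * Rabs z ^ 2 /\
     Rabs (chi3 z) <= K * Rabs z).

(** The [j]-th derivative of the rescaled profile carries [r ^ -j] and its weight is a power [4 - j]
    of [|z| / r]; the product is always [r ^ -4] times [|z| ^ (4 - j)]. *)
Lemma cutoff_exists :
  exists C, 0 <= C /\ forall r, 0 < r ->
    exists chi chi1 chi2 chi3, is_cutoff r (C / r ^ 4) chi chi1 chi2 chi3.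
Proof.
destruct unit_cutoff as (f & f1 & f2 & f3 & C & (E & E1 & E2 & E3) & D & D1 & D2 & Sf & O & HC & Hb).
exists C; split; [exact HC |]; intros r Hr.
assert (Hri : 0 < / r) by now apply Rinv_0_lt_compat.
assert (Hip : forall k, / r ^ S k = / r ^ k * / r)
  by (intros k; rewrite <- !pow_inv; simpl; ring).
exists (fun z => f (/ r * z)), (fun z => / r * f1 (/ r * z)),
  (fun z => / r ^ 2 * f2 (/ r * z)), (fun z => / r ^ 3 * f3 (/ r * z)).
assert (Hl : elem (fun z => / r * z)) by apply elem_scal, elem_id.
assert (He : forall c g, elem g -> elem (fun z => c * g (/ r * z)))
  by (intros c g Hg; now apply elem_scal, (elem_comp g)).
assert (Hd : forall c g g', (forall x, is_derive g x (g' x)) ->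
  forall z, is_derive (fun z => c * g (/ r * z)) z (c * / r * g' (/ r * z))).
{ intros c g g' Hg z.
  assert (Hi : is_derive (fun z => / r * z) z (/ r)) by (auto_derive; [trivial | ring]).
  assert (H := is_derive_comp g (fun z => / r * z) z _ _ (Hg _) Hi).
  rewrite Rmult_assoc; apply (is_derive_scal (fun z => g (/ r * z)) z c (/ r * g' (/ r * z)) H). }
split; [split; [now apply (elem_comp f) | auto] |].
split; [| split; [| split; [| split; [| split]]]].
- intros z; apply (is_derive_ext (fun z => 1 * f (/ r * z))); [intros; apply Rmult_1_l |].
  assert (H := Hd 1 f f1 D z); now rewrite Rmult_1_l in H.
- intros z; replace (/ r ^ 2) with (/ r ^ 1 * / r) by (symmetry; exact (Hip 1%nat)).
  rewrite pow_1; exact (Hd (/ r) f1 f2 D1 z).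
- intros z; rewrite (Hip 2%nat); exact (Hd (/ r ^ 2) f2 f3 D2 z).
- intros z Hz; apply Sf.
  destruct Hz; [left | right]; apply (Rmult_lt_reg_l r); auto;
    rewrite <- Rmult_assoc, Rinv_r by lra; lra.
- now rewrite Rmult_0_r.
- intros z Hz.
  assert (Ha : Rabs (/ r * z) = / r * Rabs z)
    by (rewrite Rabs_mult, (Rabs_pos_eq (/ r)); lra).
  assert (Hz1 : Rabs (/ r * z) <= 1).
  { rewrite Ha; apply (Rmult_le_reg_l r); auto.
    rewrite <- Rmult_assoc, Rinv_r by lra; lra. }
  destruct (Hb _ Hz1) as (B1 & B2 & B3).
  assert (Hp : forall k, 0 < / r ^ k) by (intros k; apply Rinv_0_lt_compat, pow_lt; lra).
  split; [| split; [| split]].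
  + set (w := / r * z) in *.
    (* As [f 0 = 1], the mean value theorem turns the cubic bound on [f1] into the quartic bound on
       [1 - f]. *)
    destruct (MVT_gen f 0 w f1) as [c [Hc1 Hc2]].
    * intros; apply D.
    * intros; now apply continuity_pt_filterlim, elem_continuous.
    * assert (Hcw : Rabs c <= Rabs w).
      { revert Hc1; unfold Rmin, Rmax, Rabs; destruct (Rle_dec 0 w); 
        destruct (Rcase_abs c); destruct (Rcase_abs w); lra. }
      destruct (Hb c ltac:(lra)) as (K & _ & _).
      rewrite <- Rabs_Ropp, Ropp_minus_distr, <- O, Hc2, Rminus_0_r, Rabs_mult.
      replace (C / r ^ 4 * Rabs z ^ 4) with (C * Rabs w ^ 3 * Rabs w)
        by (rewrite Ha; field; lra).
      apply Rmult_le_compat_r; [apply Rabs_pos |].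
      eapply Rle_trans; [exact K |].
      apply Rmult_le_compat_l; [exact HC |].
      apply pow_incr; split; [apply Rabs_pos | exact Hcw].
  + rewrite Rabs_mult, (Rabs_pos_eq (/ r)) by lra.
    apply (Rmult_le_compat_l (/ r)) in B1; [| lra].
    eapply Rle_trans; [exact B1 |]; rewrite Ha; right; field; lra.
  + specialize (Hp 2%nat); rewrite Rabs_mult, (Rabs_pos_eq (/ r ^ 2)) by lra.
    apply (Rmult_le_compat_l (/ r ^ 2)) in B2; [| lra].
    eapply Rle_trans; [exact B2 |]; rewrite Ha; right; field; lra.
  + specialize (Hp 3%nat); rewrite Rabs_mult, (Rabs_pos_eq (/ r ^ 3)) by lra.
    apply (Rmult_le_compat_l (/ r ^ 3)) in B3; [| lra].
    eapply Rle_trans; [exact B3 |]; rewrite Ha; right; field; lra.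
Qed.

(** * The heat kernel *)

Definition Theta_z (t z : R) : R := - z / (2 * t) * Theta t z.
Definition Theta_zz (t z : R) : R := (z ^ 2 / (4 * t ^ 2) - / (2 * t)) * Theta t z.

Lemma Theta_pos (t z : R) : 0 < t -> 0 < Theta t z.
Proof.
intros Ht; apply Rmult_lt_0_compat; [| apply exp_pos].
apply Rinv_0_lt_compat, sqrt_lt_R0; assert (H := PI_RGT_0); nra.
Qed.

Lemma is_derive_Theta (t z : R) : 0 < t -> is_derive (Theta t) z (Theta_z t z).
Proof.
intros Ht; unfold Theta_z, Theta.
assert (H : 0 < 4 * PI * t) by (assert (H := PI_RGT_0); nra).
assert (Hs := sqrt_lt_R0 _ H).
auto_derive; [lra |]. unfold Rdiv; simpl. field; lra.
Qed.

Lemma is_derive_Theta_z (t z : R) : 0 < t -> is_derive (Theta_z t) z (Theta_zz t z).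
Proof.
intros Ht; unfold Theta_zz, Theta_z.
evar_last.
- apply (is_derive_mult (fun z => - z / (2 * t)) (Theta t) z (- / (2 * t)) (Theta_z t z)).
  + auto_derive; [lra | field; lra].
  + now apply is_derive_Theta.
  + intros; apply Rmult_comm.
- unfold Theta_z, plus, mult; simpl; field; lra.
Qed.

(** Writing the result as [Theta_zz] encodes the heat equation of the kernel, which makes the terms
    without a derivative on [chi] cancel in the pairing. *)
Lemma is_derive_Theta_time (t z : R) :
  0 < t -> is_derive (fun s => Theta s z) t (Theta_zz t z).
Proof.
intros Ht; unfold Theta_zz, Theta.
assert (H : 0 < 4 * PI * t) by (assert (H := PI_RGT_0); nra).
assert (Hs := sqrt_lt_R0 _ H).
assert (Hq : sqrt (4 * PI * t) ^ 2 = 4 * PI * t) by (apply pow2_sqrt; lra).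
assert (HP := PI_RGT_0).
auto_derive; [repeat split; lra |].
set (e := exp _).
set (s := sqrt (4 * PI * t)) in *.
replace (- (4 * PI * 1 * / (2 * s)) * / (s * s)) with (- (/ (2 * t) / s)).
2: { replace (s * s) with (4 * PI * t) by (rewrite <- Hq; ring). field; lra. }
field; lra.
Qed.

Lemma elem_Theta (t : R) : elem (Theta t).
Proof.
apply elem_scal, (elem_comp exp); [apply elem_exp |].
apply (elem_ext (fun z => (- / (4 * t)) * z ^ 2)); [intros; unfold Rdiv; ring |].
apply elem_scal, elem_pow.
Qed.

Lemma elem_Theta_z (t : R) : elem (Theta_z t).
Proof.
apply (elem_ext (fun z => (- / (2 * t) * z) * Theta t z));
  [intros; unfold Theta_z, Rdiv; ring |].
apply (elem_mult (fun z => - / (2 * t) * z)); [apply elem_scal, elem_id | apply elem_Theta].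
Qed.

Lemma elem_Theta_zz (t : R) : elem (Theta_zz t).
Proof.
apply (elem_ext (fun z => (/ (4 * t ^ 2) * z ^ 2 + - / (2 * t)) * Theta t z));
  [intros; unfold Theta_zz, Rdiv; ring |].
apply (elem_mult (fun z => / (4 * t ^ 2) * z ^ 2 + - / (2 * t))); [| apply elem_Theta].
apply (elem_plus (fun z => / (4 * t ^ 2) * z ^ 2)); [apply elem_scal, elem_pow | apply elem_const].
Qed.

(** In the variable [q = z ^ 2 / (4 * t)] the quantity [|z| * Theta t z] depends on [q] alone, so
    the bound is free of [t]. Its square-root factor is replaced by [1 + q], using [a <= 1 + a ^ 2]
    and [1 < PI]; the two factorials then bound [q ^ k] and [q ^ (k + 1)] times [exp (- q)]. *)
Lemma Theta_weighted_bound (k : nat) (t z : R) :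
  0 < t -> (z ^ 2 / (4 * t)) ^ k * (Rabs z * Theta t z)
    <= INR (Factorial.fact k) + INR (Factorial.fact (S k)).
Proof.
intros Ht; unfold Theta.
assert (HP := PI2_3_2); assert (HP' : 1 < PI) by lra.
assert (H : 0 < 4 * PI * t) by nra.
assert (Hs := sqrt_lt_R0 _ H).
assert (Hq0 : 0 <= z ^ 2 / (4 * t))
  by (apply Rmult_le_pos; [apply pow2_ge_0 | left; apply Rinv_0_lt_compat; lra]).
replace (- z ^ 2 / (4 * t)) with (- (z ^ 2 / (4 * t))) by (field; lra).
assert (Hr : Rabs z * / sqrt (4 * PI * t) <= 1 + z ^ 2 / (4 * t)).
{ set (a := Rabs z * / sqrt (4 * PI * t)).
  assert (Ha : a ^ 2 <= z ^ 2 / (4 * t)).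
  { unfold a; rewrite Rpow_mult_distr, pow2_abs, pow_inv, pow2_sqrt by lra.
    apply Rmult_le_compat_l; [apply pow2_ge_0 |].
    apply Rinv_le_contravar; nra. }
  assert (0 <= (a - 1) ^ 2) by apply pow2_ge_0. nra. }
set (q := z ^ 2 / (4 * t)) in *.
assert (H1 := pow_mul_exp_neg_le k q Hq0).
assert (H2 := pow_mul_exp_neg_le (S k) q Hq0).
assert (Hp : 0 <= q ^ k * exp (- q))
  by (apply Rmult_le_pos; [now apply pow_le | left; apply exp_pos]).
apply Rle_trans with (q ^ k * exp (- q) * (1 + q)).
- replace (q ^ k * (Rabs z * (/ sqrt (4 * PI * t) * exp (- q)))) with
    (q ^ k * exp (- q) * (Rabs z * / sqrt (4 * PI * t))) by ring.
  now apply Rmult_le_compat_l.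
- simpl in H2 |- *; lra.
Qed.

(** For [k = 0, 1, 2] the weighted bounds are 2, 3 and 8. The worst cases are [4 * 8 + 2 * 3 = 38]
    and [8 * t * 8 = 64 * t], rounded up to 40 and [80 * t]. The first three are uniform in time and
    control the commutator; the last two spend two further powers of [|z|] on a factor [t], for
    removing the cutoff at a fixed time. *)
Lemma Theta_bounds (t z : R) :
  0 < t ->
  Rabs z * Theta t z <= 40 /\
  Rabs z ^ 2 * Rabs (Theta_z t z) <= 40 /\
  Rabs z ^ 3 * Rabs (Theta_zz t z) <= 40 /\
  Rabs z ^ 3 * Theta t z <= 80 * t /\
  Rabs z ^ 4 * Rabs (Theta_z t z) <= 80 * t.
Proof.
intros Ht.
assert (B0 := Theta_weighted_bound 0 t z Ht).
assert (B1 := Theta_weighted_bound 1 t z Ht).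
assert (B2 := Theta_weighted_bound 2 t z Ht).
assert (HT := Theta_pos t z Ht); assert (Hz := Rabs_pos z).
simpl Factorial.fact in B0, B1, B2; simpl INR in B0, B1, B2.
rewrite pow_O in B0; rewrite pow_1 in B1.
assert (Hq0 : 0 <= z ^ 2 / (4 * t))
  by (apply Rmult_le_pos; [apply pow2_ge_0 | left; apply Rinv_0_lt_compat; lra]).
assert (E1 : Rabs (Theta_z t z) = Rabs z / (2 * t) * Theta t z).
{ unfold Theta_z, Rdiv; rewrite !Rabs_mult, Rabs_Ropp, (Rabs_pos_eq (Theta t z)) by lra.
  rewrite (Rabs_pos_eq (/ (2 * t))); [reflexivity |].
  left; apply Rinv_0_lt_compat; lra. }
set (q := z ^ 2 / (4 * t)) in *; set (b := Rabs z * Theta t z) in *.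
assert (Hzq : Rabs z ^ 2 = 4 * t * q) by (rewrite pow2_abs; unfold q; field; lra).
assert (Hb : 0 <= b) by (apply Rmult_le_pos; lra).
split; [lra |]; split; [| split; [| split]].
- replace (Rabs z ^ 2 * Rabs (Theta_z t z)) with (Rabs z ^ 2 / (2 * t) * b)
    by (rewrite E1; unfold b; field; lra).
  rewrite Hzq; replace (4 * t * q / (2 * t)) with (2 * q) by (field; lra); lra.
- replace (Rabs z ^ 3 * Rabs (Theta_zz t z)) with (Rabs (4 * q ^ 2 - 2 * q) * b).
  + apply Rle_trans with ((4 * q ^ 2 + 2 * q) * b); [| simpl; lra].
    apply Rmult_le_compat_r; [exact Hb |].
    apply Rabs_le; simpl; nra.
  + unfold Theta_zz; rewrite Rabs_mult, (Rabs_pos_eq (Theta t z)) by lra.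
    replace (z ^ 2 / (4 * t ^ 2) - / (2 * t)) with ((q - / 2) / t)
      by (unfold q; field; lra).
    replace (4 * q ^ 2 - 2 * q) with (4 * q * t * ((q - / 2) / t)) by (field; lra).
    rewrite Rabs_mult, (Rabs_pos_eq (4 * q * t)) by nra.
    replace (Rabs z ^ 3) with (Rabs z ^ 2 * Rabs z) by ring.
    rewrite Hzq; unfold b; ring.
- replace (Rabs z ^ 3 * Theta t z) with (Rabs z ^ 2 * b) by (unfold b; ring).
  rewrite Hzq; nra.
- replace (Rabs z ^ 4 * Rabs (Theta_z t z)) with (Rabs z ^ 2 * Rabs z ^ 2 / (2 * t) * b)
    by (rewrite E1; unfold b; field; lra).
  rewrite Hzq; replace (4 * t * q * (4 * t * q) / (2 * t)) with (8 * t * q ^ 2) by (field; lra).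
  nra.
Qed.

Lemma continuous_Theta {T : UniformSpace} (f g : T -> R) (x : T) :
  0 < f x -> continuous f x -> continuous g x ->
  continuous (fun p => Theta (f p) (g p)) x.
Proof.
intros Hp Hf Hg; unfold Theta.
assert (H : 0 < 4 * PI * f x) by (assert (H := PI_RGT_0); nra).
assert (Hs := sqrt_lt_R0 _ H).
apply (continuous_mult (K := R_AbsRing)).
- apply (continuous_comp (fun p => sqrt (4 * PI * f p)) Rinv).
  + apply (continuous_comp (fun p => 4 * PI * f p) sqrt).
    * apply (continuous_mult (K := R_AbsRing)); [apply continuous_const | exact Hf].
    * apply continuous_sqrt.
  + apply continuous_Rinv; lra.
- apply (continuous_comp (fun p => - g p ^ 2 / (4 * f p)) exp); [| apply continuous_exp].
  apply (continuous_mult (K := R_AbsRing)).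
  + apply (continuous_opp (V := R_NormedModule)); simpl.
    apply (continuous_mult (K := R_AbsRing)); [exact Hg |].
    apply (continuous_mult (K := R_AbsRing)); [exact Hg | apply continuous_const].
  + apply (continuous_comp (fun p => 4 * f p) Rinv).
    * apply (continuous_mult (K := R_AbsRing)); [apply continuous_const | exact Hf].
    * apply continuous_Rinv; lra.
Qed.

Lemma continuous_Theta_zz {T : UniformSpace} (f g : T -> R) (x : T) :
  0 < f x -> continuous f x -> continuous g x ->
  continuous (fun p => Theta_zz (f p) (g p)) x.
Proof.
intros Hp Hf Hg; unfold Theta_zz.
assert (Hg2 : continuous (fun p => g p ^ 2) x).
{ simpl; apply (continuous_mult (K := R_AbsRing)); [exact Hg |].
  apply (continuous_mult (K := R_AbsRing)); [exact Hg | apply continuous_const]. }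
apply (continuous_mult (K := R_AbsRing)); [| now apply continuous_Theta].
apply (continuous_minus (V := R_NormedModule)).
- apply (continuous_mult (K := R_AbsRing)); [exact Hg2 |].
  apply (continuous_comp (fun p => 4 * f p ^ 2) Rinv).
  + simpl; apply (continuous_mult (K := R_AbsRing)); [apply continuous_const |].
    apply (continuous_mult (K := R_AbsRing)); [exact Hf |].
    apply (continuous_mult (K := R_AbsRing)); [exact Hf | apply continuous_const].
  + apply continuous_Rinv; simpl; nra.
- apply (continuous_comp (fun p => 2 * f p) Rinv).
  + apply (continuous_mult (K := R_AbsRing)); [apply continuous_const | exact Hf].
  + apply continuous_Rinv; lra.
Qed.

(** * The Gaussian integral and the mass of the kernel *)

Definition gauss (x : R) : R := RInt (fun q => exp (- q ^ 2)) 0 x.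

Lemma continuous_exp_neg_sq (x : R) : continuous (fun q => exp (- q ^ 2)) x.
Proof. apply (ex_derive_continuous (fun q => exp (- q ^ 2))); auto_derive; trivial. Qed.

Lemma is_derive_gauss (x : R) : is_derive gauss x (exp (- x ^ 2)).
Proof.
apply (is_derive_RInt (fun q => exp (- q ^ 2)) gauss 0 x).
- exists (mkposreal 1 Rlt_0_1); intros y _.
  apply (@RInt_correct R_CompleteNormedModule), (@ex_RInt_continuous R_CompleteNormedModule).
  intros; apply continuous_exp_neg_sq.
- apply continuous_exp_neg_sq.
Qed.

(** The companion integral of the classical evaluation of the Gaussian integral: its derivative is
    opposite to that of [gauss x ^ 2], and its value at 0 is an arctangent integral. *)
Definition gauss_compl (x : R) : R :=
  RInt (fun s => exp (- x ^ 2 * (1 + s ^ 2)) / (1 + s ^ 2)) 0 1.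

(** The substitution [q = x * s] moves the integral to the fixed interval [[0, 1]], the form in
    which it appears on differentiating [gauss_compl]; it also exhibits the oddness in [x]. *)
Lemma gauss_scaled (x : R) :
  RInt (fun s => x * exp (- (x * s) ^ 2)) 0 1 = gauss x.
Proof.
assert (H := RInt_comp_lin (fun q => exp (- q ^ 2)) x 0 0 1).
unfold gauss.
replace (x * 0 + 0) with 0 in H by ring. replace (x * 1 + 0) with x in H by ring.
rewrite <- H.
- apply RInt_ext; intros s _; unfold scal; simpl; unfold mult; simpl.
  now rewrite Rplus_0_r.
- apply (@ex_RInt_continuous R_CompleteNormedModule); intros; apply continuous_exp_neg_sq.
Qed.

(** Differentiating in [x] under the integral cancels the denominator [1 + s ^ 2]; then
    [exp (- x ^ 2)] factors out and [gauss_scaled] recognises the rest. *)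
Lemma is_derive_gauss_compl (x : R) :
  is_derive gauss_compl x (- (2 * exp (- x ^ 2) * gauss x)).
Proof.
assert (Hd : forall y s, is_derive (fun y => exp (- y ^ 2 * (1 + s ^ 2)) / (1 + s ^ 2)) y
   (- (2 * y) * exp (- y ^ 2 * (1 + s ^ 2)))).
{ intros y s; assert (0 < 1 + s ^ 2) by (assert (0 <= s ^ 2) by apply pow2_ge_0; lra).
  auto_derive; [trivial |].
  replace (y * (y * 1)) with (y ^ 2) by ring. replace (s * (s * 1)) with (s ^ 2) by ring.
  field; lra. }
evar_last.
- apply (is_derive_RInt_param (fun y s => exp (- y ^ 2 * (1 + s ^ 2)) / (1 + s ^ 2))).
  + exists (mkposreal 1 Rlt_0_1); intros y _ s _; eexists; apply Hd.
  + intros s _.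
    apply (continuity_2d_pt_ext (fun y s => - (2 * y) * exp (- y ^ 2 * (1 + s ^ 2)))).
    { intros; symmetry; apply is_derive_unique, Hd. }
    apply continuity_2d_pt_filterlim.
    apply (continuous_mult (K := R_AbsRing) (fun z : R * R => - (2 * fst z))
      (fun z : R * R => exp (- fst z ^ 2 * (1 + snd z ^ 2)))).
    * apply (continuous_opp (V := R_NormedModule) (fun z : R * R => 2 * fst z)).
      apply (continuous_mult (K := R_AbsRing)); [apply continuous_const | apply continuous_fst].
    * apply (continuous_comp (fun z : R * R => - fst z ^ 2 * (1 + snd z ^ 2)) exp);
        [| apply continuous_exp].
      apply (continuous_mult (K := R_AbsRing)).
      -- apply (continuous_opp (V := R_NormedModule)); simpl.
         apply (continuous_mult (K := R_AbsRing)); [apply continuous_fst |].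
         apply (continuous_mult (K := R_AbsRing)); [apply continuous_fst | apply continuous_const].
      -- apply (continuous_plus (V := R_NormedModule)); [apply continuous_const |]; simpl.
         apply (continuous_mult (K := R_AbsRing)); [apply continuous_snd |].
         apply (continuous_mult (K := R_AbsRing)); [apply continuous_snd | apply continuous_const].
  + exists (mkposreal 1 Rlt_0_1); intros y _.
    apply (@ex_RInt_continuous R_CompleteNormedModule); intros s _.
    apply (ex_derive_continuous (fun s => exp (- y ^ 2 * (1 + s ^ 2)) / (1 + s ^ 2))).
    assert (0 < 1 + s ^ 2) by (assert (0 <= s ^ 2) by apply pow2_ge_0; lra).
    auto_derive; simpl in *; lra.
- rewrite <- gauss_scaled.
  transitivity (RInt (fun s => scal (- (2 * exp (- x ^ 2))) (x * exp (- (x * s) ^ 2))) 0 1).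
  + apply RInt_ext; intros s _; etransitivity; [exact (is_derive_unique _ _ _ (Hd x s)) |].
    replace (- x ^ 2 * (1 + s ^ 2)) with (- x ^ 2 + - (x * s) ^ 2) by ring.
    rewrite exp_plus; unfold scal; simpl; unfold mult; simpl; ring.
  + rewrite (@RInt_scal R_CompleteNormedModule).
    * unfold scal; simpl; unfold mult; simpl; ring.
    * apply (@ex_RInt_continuous R_CompleteNormedModule); intros s _.
      apply (ex_derive_continuous (fun s => x * exp (- (x * s) ^ 2))); auto_derive; trivial.
Qed.

Lemma gauss_sq (x : R) : gauss x ^ 2 + gauss_compl x = PI / 4.
Proof.
assert (Hd : forall y, is_derive (fun y => gauss y ^ 2 + gauss_compl y) y 0).
{ intros y; evar_last.
  - apply (is_derive_plus (fun y => gauss y ^ 2) gauss_compl).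
    + apply (is_derive_pow gauss 2), is_derive_gauss.
    + apply is_derive_gauss_compl.
  - unfold plus; simpl; ring. }
assert (H0 : gauss 0 ^ 2 + gauss_compl 0 = PI / 4).
{ unfold gauss, gauss_compl; rewrite RInt_point.
  rewrite (RInt_ext _ (fun s => / (1 + s ^ 2))).
  - rewrite <- atan_1.
    assert (H : is_RInt (fun s => / (1 + s ^ 2)) 0 1 (atan 1 - atan 0)).
    { apply (is_RInt_derive atan).
      - intros; apply is_derive_Reals, derivable_pt_lim_atan.
      - intros s _; apply (ex_derive_continuous (fun s => / (1 + s ^ 2))).
        assert (0 < 1 + s ^ 2) by (assert (0 <= s ^ 2) by apply pow2_ge_0; lra).
        auto_derive; simpl in *; lra. }
    rewrite (is_RInt_unique (V := R_CompleteNormedModule) _ _ _ _ H), atan_0.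
    change (0 ^ 2 + (atan 1 - 0) = atan 1); ring.
  - intros s _; replace (- 0 ^ 2 * (1 + s ^ 2)) with 0 by ring; rewrite exp_0.
    unfold Rdiv; apply Rmult_1_l. }
rewrite <- H0.
destruct (MVT_gen (fun y => gauss y ^ 2 + gauss_compl y) 0 x (fun _ => 0)) as [c [_ Hc]].
- intros; apply Hd.
- intros y _; apply continuity_pt_filterlim.
  apply (ex_derive_continuous (fun y => gauss y ^ 2 + gauss_compl y)); eexists; apply Hd.
- lra.
Qed.

Lemma gauss_compl_bounds (x : R) : 0 <= gauss_compl x <= exp (- x ^ 2).
Proof.
assert (Hs : forall s, 1 <= 1 + s ^ 2) by (intros s; assert (0 <= s ^ 2) by apply pow2_ge_0; lra).
assert (He : ex_RInt (fun s => exp (- x ^ 2 * (1 + s ^ 2)) / (1 + s ^ 2)) 0 1).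
{ apply (@ex_RInt_continuous R_CompleteNormedModule); intros s _.
  apply (ex_derive_continuous (fun s => exp (- x ^ 2 * (1 + s ^ 2)) / (1 + s ^ 2))).
  specialize (Hs s); auto_derive; simpl in *; lra. }
assert (Hp : forall s, 0 <= exp (- x ^ 2 * (1 + s ^ 2)) / (1 + s ^ 2) <= exp (- x ^ 2)).
{ intros s; specialize (Hs s).
  assert (H1 := exp_pos (- x ^ 2 * (1 + s ^ 2))).
  assert (H2 : / (1 + s ^ 2) <= 1) by (rewrite <- Rinv_1; apply Rinv_le_contravar; lra).
  assert (H3 : 0 < / (1 + s ^ 2)) by (apply Rinv_0_lt_compat; lra).
  assert (exp (- x ^ 2 * (1 + s ^ 2)) <= exp (- x ^ 2)).
  { destruct (Req_dec (- x ^ 2 * (1 + s ^ 2)) (- x ^ 2)) as [E|E]; [rewrite E; lra |].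
    left; apply exp_increasing; assert (0 <= x ^ 2) by apply pow2_ge_0; nra. }
  unfold Rdiv; split; nra. }
split.
- apply RInt_ge_0; [lra | exact He | intros; apply Hp].
- unfold gauss_compl; apply Rle_trans with (RInt (fun _ => exp (- x ^ 2)) 0 1).
  + apply RInt_le; [lra | exact He | apply ex_RInt_const | intros; apply Hp].
  + rewrite RInt_const; unfold scal; simpl; unfold mult; simpl; lra.
Qed.

Lemma gauss_opp (x : R) : gauss (- x) = - gauss x.
Proof.
rewrite <- !gauss_scaled.
rewrite (RInt_ext (fun s => - x * exp (- (- x * s) ^ 2)) (fun s => opp (x * exp (- (x * s) ^ 2)))).
- apply (@RInt_opp R_CompleteNormedModule).
  apply (@ex_RInt_continuous R_CompleteNormedModule); intros s _.
  apply (ex_derive_continuous (fun s => x * exp (- (x * s) ^ 2))); auto_derive; trivial.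
- intros s _; change (- x * exp (- (- x * s) ^ 2) = - (x * exp (- (x * s) ^ 2))).
  replace ((- x * s) ^ 2) with ((x * s) ^ 2) by ring; ring.
Qed.

(** By [gauss_sq] the square of the normalised integral [s] is 1 minus a multiple of [gauss_compl x]
    lying in [[0, 2 / x ^ 2]]. As [0 <= s <= 1], also [s ^ 2 <= s], so the lower bound needs no
    square root. *)
Lemma gauss_bounds (x : R) :
  0 < x -> 1 - 2 / x ^ 2 <= 2 / sqrt PI * gauss x <= 1.
Proof.
intros Hx.
assert (H1 := gauss_sq x); destruct (gauss_compl_bounds x) as [H2 H3].
assert (Hg : 0 <= gauss x).
{ apply RInt_ge_0; [lra | | intros; left; apply exp_pos].
  apply (@ex_RInt_continuous R_CompleteNormedModule); intros; apply continuous_exp_neg_sq. }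
assert (HP := PI2_3_2).
assert (Hs := sqrt_lt_R0 PI ltac:(lra)).
assert (Hq : sqrt PI ^ 2 = PI) by (apply pow2_sqrt; lra).
set (s := 2 / sqrt PI * gauss x).
assert (Hs0 : 0 <= s).
{ apply Rmult_le_pos; [| exact Hg]; unfold Rdiv; apply Rmult_le_pos; [lra |].
  left; now apply Rinv_0_lt_compat. }
assert (Hs2 : s ^ 2 = 1 - 4 / PI * gauss_compl x).
{ unfold s; replace (gauss_compl x) with (PI / 4 - gauss x ^ 2) by lra.
  replace ((2 / sqrt PI * gauss x) ^ 2) with (4 / (sqrt PI ^ 2) * gauss x ^ 2) by (field; lra).
  rewrite Hq; field; lra. }
assert (He : exp (- x ^ 2) <= / x ^ 2).
{ assert (H0 : 0 < x ^ 2) by (apply pow_lt; lra).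
  assert (H := pow_mul_exp_neg_le 1 (x ^ 2) (Rlt_le _ _ H0)).
  apply (Rmult_le_reg_l (x ^ 2)); [exact H0 |].
  rewrite Rinv_r by lra; simpl Factorial.fact in H; simpl INR in H; lra. }
assert (Hc : 0 <= 4 / PI * gauss_compl x <= 2 / x ^ 2).
{ assert (0 < / PI) by (apply Rinv_0_lt_compat; lra).
  assert (/ PI <= / 2) by (apply Rinv_le_contravar; lra).
  unfold Rdiv; split; nra. }
split; nra.
Qed.

(** The substitution [q = z / (2 * sqrt t)] reduces this to [gauss_bounds] at [c * r], where
    [2 / (c * r) ^ 2 = 8 * t / r ^ 2]. *)
Lemma Theta_integral_bounds (t r : R) :
  0 < t -> 0 < r -> 1 - 8 * t / r ^ 2 <= RInt (Theta t) (- r) r <= 1.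
Proof.
intros Ht Hr.
assert (Hs := sqrt_lt_R0 t Ht).
assert (Hst : sqrt t ^ 2 = t) by (apply pow2_sqrt; lra).
assert (HP := PI_RGT_0).
assert (HsP := sqrt_lt_R0 PI HP).
set (c := / (2 * sqrt t)).
assert (Hc : 0 < c) by (apply Rinv_0_lt_compat; lra).
assert (Hc2 : c ^ 2 = / (4 * t)).
{ rewrite <- Hst; unfold c; field; lra. }
assert (H : is_RInt (Theta t) (- r) r (/ sqrt PI * gauss (c * r) - / sqrt PI * gauss (c * - r))).
{ apply (is_RInt_derive (fun z => / sqrt PI * gauss (c * z))).
  - intros z _.
    evar_last.
    + apply (is_derive_scal (fun z => gauss (c * z)) z (/ sqrt PI) (c * exp (- (c * z) ^ 2))).
      apply (is_derive_comp gauss (fun z => c * z)); [apply is_derive_gauss |].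
      auto_derive; [trivial | ring].
    + unfold Theta.
      rewrite Rpow_mult_distr, Hc2.
      replace (- z ^ 2 / (4 * t)) with (- (/ (4 * t) * z ^ 2)) by (field; lra).
      rewrite <- Rmult_assoc; f_equal.
      replace (4 * PI * t) with (PI * (2 * sqrt t) ^ 2) by (rewrite Rpow_mult_distr, Hst; ring).
      rewrite sqrt_mult, sqrt_pow2 by (try apply pow2_ge_0; lra).
      unfold c; field; lra.
  - intros z _; apply elem_continuous, elem_Theta. }
rewrite (is_RInt_unique (V := R_CompleteNormedModule) _ _ _ _ H).
replace (c * - r) with (- (c * r)) by ring; rewrite gauss_opp.
replace (/ sqrt PI * gauss (c * r) - / sqrt PI * - gauss (c * r))
  with (2 / sqrt PI * gauss (c * r)) by (field; lra).
replace (8 * t / r ^ 2) with (2 / (c * r) ^ 2).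
- apply gauss_bounds; apply Rmult_lt_0_compat; lra.
- rewrite Rpow_mult_distr, Hc2; field; lra.
Qed.

(** * The heat kernel as an approximate identity *)

Lemma continuity_2d_pt_slice (k : R -> R -> R) (x y : R) :
  continuity_2d_pt k x y -> continuous (fun z => k z y) x.
Proof.
intros H; apply continuity_2d_pt_filterlim in H.
apply (continuous_comp_2 (fun z : R => z) (fun _ : R => y) k);
  [apply continuous_id | apply continuous_const | exact H].
Qed.

Lemma ex_RInt_continuous_on (f : R -> R) (a b : R) :
  a <= b -> (forall z, a <= z <= b -> continuous f z) -> ex_RInt f a b.
Proof.
intros Hab Hf; apply (@ex_RInt_continuous R_CompleteNormedModule).
rewrite Rmin_left, Rmax_right by exact Hab; exact Hf.
Qed.

Lemma abs_RInt_le_RInt (f g : R -> R) (a b : R) :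
  a <= b -> ex_RInt f a b -> ex_RInt g a b ->
  (forall x, a <= x <= b -> Rabs (f x) <= g x) -> Rabs (RInt f a b) <= RInt g a b.
Proof.
intros Hab Hf Hg H.
apply (norm_RInt_le f g a b); auto.
- exact (RInt_correct (V := R_CompleteNormedModule) f a b Hf).
- exact (RInt_correct (V := R_CompleteNormedModule) g a b Hg).
Qed.

(** The function [- 2 * t * z * Theta t z] is a primitive of [z ^ 2 * Theta - 2 * t * Theta], and
    its boundary contributions are nonpositive; the total mass is at most 1. *)
Lemma Theta_second_moment (t r : R) :
  0 < t -> 0 < r -> RInt (fun z => z ^ 2 * Theta t z) (- r) r <= 2 * t.
Proof.
intros Ht Hr.
assert (Hc : forall z, continuous (Theta t) z) by (intros; apply elem_continuous, elem_Theta).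
assert (H : is_RInt (fun z => z ^ 2 * Theta t z - 2 * t * Theta t z) (- r) r
  (- (2 * t) * (r * Theta t r) - - (2 * t) * (- r * Theta t (- r)))).
{ apply (is_RInt_derive (fun z => - (2 * t) * (z * Theta t z))).
  - intros z _; evar_last.
    + apply (is_derive_scal (fun z => z * Theta t z) z (- (2 * t))).
      apply (is_derive_mult (fun z => z) (Theta t)).
      * apply (is_derive_id (K := R_AbsRing)).
      * now apply is_derive_Theta.
      * intros; apply Rmult_comm.
    + unfold Theta_z, plus, mult, one; simpl; field; lra.
  - intros z _; apply elem_continuous.
    apply (elem_ext (fun z => z ^ 2 * Theta t z + (- (2 * t)) * Theta t z)); [intros; ring |].
    apply elem_plus; [apply (elem_mult (fun z => z ^ 2)); [apply elem_pow |] | apply elem_scal];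
      apply elem_Theta. }
assert (H1 : is_RInt (Theta t) (- r) r (RInt (Theta t) (- r) r)).
{ apply (RInt_correct (V := R_CompleteNormedModule)), ex_RInt_continuous_on; [lra | auto]. }
assert (H2 := is_RInt_plus _ _ _ _ _ _ H (is_RInt_scal _ _ _ (2 * t) _ H1)).
rewrite (RInt_ext _ (fun z => plus (z ^ 2 * Theta t z - 2 * t * Theta t z) (scal (2 * t) (Theta t z)))).
- eapply Rle_trans; [right; exact (is_RInt_unique (V := R_CompleteNormedModule) _ _ _ _ H2) |].
  unfold plus, scal; simpl; unfold mult; simpl.
  assert (P1 := Theta_pos t r Ht); assert (P2 := Theta_pos t (- r) Ht).
  assert (P3 := proj2 (Theta_integral_bounds t r Ht Hr)).
  assert (0 <= t * r * Theta t r) by (apply Rmult_le_pos; [nra | lra]).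
  assert (0 <= t * r * Theta t (- r)) by (apply Rmult_le_pos; [nra | lra]).
  nra.
- intros z _; unfold plus, scal; simpl; unfold mult; simpl.
  match goal with |- ?a = ?b => change (@eq R a b) end; ring.
Qed.

(** The function tested moves with [t] as well, so joint uniform continuity on a compact rectangle
    replaces continuity at a point. The interval [[T / 2, T]] stays away from time 0, where nothing
    is known of the solution. *)
Lemma Theta_approx_identity (k : R -> R -> R) (r T : R) :
  0 < r -> 0 < T ->
  (forall z s, - r <= z <= r -> T / 2 <= s <= T -> continuity_2d_pt k z s) ->
  forall eps, 0 < eps -> exists d, 0 < d /\ forall t, 0 < t < d ->
    Rabs (RInt (fun z => k z (T - t) * Theta t z) (- r) r - k 0 T) <= eps.
Proof.
intros Hr HT Hk eps Heps.
assert (He : 0 < eps / 4) by lra.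
destruct (uniform_continuity_2d k (- r) r (T / 2) T Hk (mkposreal _ He)) as [del Hdel].
simpl in Hdel; assert (Hd0 := cond_pos del).
destruct (continuous_bounded (fun z => k z T) (- r) r) as [M [HM0 HM]].
{ intros z Hz; apply continuity_2d_pt_slice, Hk; lra. }
(* Where [|z| >= del], the crude bound [2 * M] on the spatial difference is at most [D * z ^ 2],
   whose integral against the kernel is at most [2 * t * D] by the second moment. *)
set (D := 2 * M / del ^ 2).
assert (HD : 0 <= D).
{ apply Rmult_le_pos; [lra | left; apply Rinv_0_lt_compat, pow_lt; lra]. }
(* Both errors linear in [t]: [2 * D] from the second moment, and [8 * M / r ^ 2] from the mass of
   the kernel missing on [[-r, r]]. *)
set (E := 2 * D + 8 * M / r ^ 2).
assert (Hr2 : 0 < / r ^ 2) by (apply Rinv_0_lt_compat, pow_lt; lra).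
assert (HE : 0 <= E).
{ apply Rplus_le_le_0_compat; [lra |]; apply Rmult_le_pos; lra. }
assert (HE2 : 0 < eps / 4 / (E + 1)) by (apply Rdiv_lt_0_compat; lra).
exists (Rmin (Rmin del (T / 2)) (eps / 4 / (E + 1))).
split; [repeat apply Rmin_pos; lra |].
intros t [Ht0 Ht].
assert (Ht1 : t < del) by (eapply Rlt_le_trans; [exact Ht |];
  eapply Rle_trans; [apply Rmin_l | apply Rmin_l]).
assert (Ht2 : t < T / 2) by (eapply Rlt_le_trans; [exact Ht |];
  eapply Rle_trans; [apply Rmin_l | apply Rmin_r]).
assert (Ht3 : t * E <= eps / 4).
{ assert (Ht3 : t < eps / 4 / (E + 1)) by (eapply Rlt_le_trans; [exact Ht | apply Rmin_r]).
  apply (Rmult_lt_compat_r (E + 1)) in Ht3; [| lra].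
  replace (eps / 4 / (E + 1) * (E + 1)) with (eps / 4) in Ht3 by (field; lra). nra. }
assert (HTc : forall z, continuous (Theta t) z) by (intros; apply elem_continuous, elem_Theta).
assert (Hkc : forall z, - r <= z <= r -> continuous (fun z => k z (T - t)) z).
{ intros z Hz; apply continuity_2d_pt_slice, Hk; lra. }
assert (Hpt : forall z, - r <= z <= r ->
  Rabs (k z (T - t) - k 0 T) <= eps / 4 + D * z ^ 2).
{ intros z Hz.
  assert (Hz2 : 0 <= D * z ^ 2) by (apply Rmult_le_pos; [lra | apply pow2_ge_0]).
  assert (Hs : Rabs (T - t - T) < del).
  { replace (T - t - T) with (- t) by ring; rewrite Rabs_Ropp, Rabs_pos_eq; lra. }
  destruct (Rlt_dec (Rabs z) del) as [H|H].
  - specialize (Hdel 0 T z (T - t)); rewrite Rminus_0_r in Hdel.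
    enough (Rabs (k z (T - t) - k 0 T) < eps / 4) by lra.
    apply Hdel; lra.
  - replace (k z (T - t) - k 0 T) with ((k z (T - t) - k z T) + (k z T - k 0 T)) by ring.
    eapply Rle_trans; [apply Rabs_triang |].
    apply Rplus_le_compat.
    + left; apply Hdel; try lra; unfold Rminus; rewrite Rplus_opp_r, Rabs_R0; lra.
    + apply Rle_trans with (2 * M).
      * assert (A := HM z Hz); assert (B := HM 0 ltac:(lra)).
        eapply Rle_trans; [apply Rabs_triang |]; rewrite Rabs_Ropp; simpl in *; lra.
      * replace (2 * M) with (D * del ^ 2) by (unfold D; field; lra).
        apply Rmult_le_compat_l; [lra |].
        rewrite <- (pow2_abs z); apply pow_incr; lra. }
assert (Hex : ex_RInt (Theta t) (- r) r) by (apply ex_RInt_continuous_on; [lra | auto]).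
assert (Hex2 : ex_RInt (fun z => z ^ 2 * Theta t z) (- r) r).
{ apply ex_RInt_continuous_on; [lra |]; intros; apply elem_continuous.
  apply (elem_mult (fun z => z ^ 2)); [apply elem_pow | apply elem_Theta]. }
assert (Hexk : ex_RInt (fun z => k z (T - t) * Theta t z) (- r) r).
{ apply ex_RInt_continuous_on; [lra |]; intros z Hz.
  apply (continuous_mult (K := R_AbsRing)); auto. }
assert (Hex0 : ex_RInt (fun z => k 0 T * Theta t z) (- r) r)
  by exact (ex_RInt_scal (V := R_NormedModule) _ _ _ _ Hex).
assert (Hsplit : RInt (fun z => (k z (T - t) - k 0 T) * Theta t z) (- r) r =
  RInt (fun z => k z (T - t) * Theta t z) (- r) r - k 0 T * RInt (Theta t) (- r) r).
{ transitivity (RInt (fun z => minus (k z (T - t) * Theta t z) (k 0 T * Theta t z)) (- r) r).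
  - apply RInt_ext; intros z _; apply Rmult_minus_distr_r.
  - rewrite (@RInt_minus R_CompleteNormedModule) by assumption.
    unfold minus, plus, opp; simpl; unfold Rminus; do 2 f_equal.
    exact (RInt_scal (V := R_CompleteNormedModule) (Theta t) _ _ (k 0 T) Hex). }
assert (Hmain : Rabs (RInt (fun z => (k z (T - t) - k 0 T) * Theta t z) (- r) r)
  <= eps / 4 + 2 * t * D).
{ eapply Rle_trans.
  - apply (abs_RInt_le_RInt _ (fun z => plus (scal (eps / 4) (Theta t z))
      (scal D (z ^ 2 * Theta t z)))).
    + lra.
    + apply ex_RInt_continuous_on; [lra |]; intros z Hz.
      apply (continuous_mult (K := R_AbsRing)); [| auto].
      apply (continuous_minus (V := R_NormedModule)); [auto | apply continuous_const].
    + apply (ex_RInt_plus (V := R_NormedModule)); now apply (ex_RInt_scal (V := R_NormedModule)).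
    + intros z Hz; assert (HTp := Theta_pos t z Ht0).
      rewrite Rabs_mult, (Rabs_pos_eq (Theta t z)) by lra.
      eapply Rle_trans; [apply Rmult_le_compat_r; [lra | apply (Hpt z Hz)] |].
      unfold plus, scal; simpl; unfold mult; simpl; lra.
  - rewrite (@RInt_plus R_CompleteNormedModule), !(@RInt_scal R_CompleteNormedModule);
      try assumption; try now apply (ex_RInt_scal (V := R_NormedModule)).
    unfold plus, scal; simpl; unfold mult; simpl.
    assert (A := Theta_integral_bounds t r Ht0 Hr).
    assert (B := Theta_second_moment t r Ht0 Hr).
    simpl in A, B; nra. }
rewrite Hsplit in Hmain.
set (J := RInt (fun z => k z (T - t) * Theta t z) (- r) r) in *.
assert (A := Theta_integral_bounds t r Ht0 Hr).
set (G := RInt (Theta t) (- r) r) in *.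
replace (J - k 0 T) with ((J - k 0 T * G) + - (k 0 T * (1 - G))) by ring.
eapply Rle_trans; [apply Rabs_triang |].
rewrite Rabs_Ropp, Rabs_mult, (Rabs_pos_eq (1 - G)) by lra.
assert (HB : Rabs (k 0 T) * (1 - G) <= M * (8 * t / r ^ 2)).
{ apply Rmult_le_compat; [apply Rabs_pos | lra | apply HM; lra | lra]. }
replace (t * E) with (2 * t * D + M * (8 * t / r ^ 2)) in Ht3 by (unfold E; field; lra).
lra.
Qed.

(** * The Alexiewicz norm *)

Lemma alex_norm_osc (F : R -> R) (M : R) :
  Rbar_le (alex_norm F) M -> forall x y, Rabs (F y - F x) <= M.
Proof.
intros H.
assert (Hlt : forall x y, x < y -> Rabs (F y - F x) <= M).
{ intros x y Hxy.
  assert (H1 : Rbar_le (Rabs (F y - F x)) (alex_norm F)).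
  { apply (proj1 (Lub_Rbar_correct _)); now exists x, y. }
  exact (Rbar_le_trans _ _ _ H1 H). }
intros x y; destruct (Rtotal_order x y) as [Hxy|[Hxy|Hxy]].
- now apply Hlt.
- subst y; unfold Rminus; rewrite Rplus_opp_r, Rabs_R0.
  (* Any pair of distinct points shows [0 <= M], which settles the degenerate pair. *)
  assert (K := Hlt 0 1 Rlt_0_1); assert (K' := Rabs_pos (F 1 - F 0)); lra.
- rewrite Rabs_minus_sym; now apply Hlt.
Qed.

(** The normalisation at minus infinity turns an oscillation bound into a bound on values: compare
    [y] with a point so far to the left that [F] is within [eps] of 0 there. *)
Lemma alex_norm_sup (F : R -> R) (M : R) :
  is_lim F m_infty 0 -> Rbar_le (alex_norm F) M -> forall y, Rabs (F y) <= M.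
Proof.
intros Hl H y; apply le_epsilon; intros eps Heps.
destruct (proj2 (is_lim_spec F m_infty 0) Hl (mkposreal eps Heps)) as [A HA].
specialize (HA (A - 1) ltac:(lra)); simpl in HA.
assert (K := alex_norm_osc F M H (A - 1) y).
replace (F y) with ((F y - F (A - 1)) + (F (A - 1) - 0)) by ring.
eapply Rle_trans; [apply Rabs_triang |]; lra.
Qed.

(** The difference of two normalised primitives again vanishes at minus infinity, so [alex_norm_sup]
    applies to it. *)
Lemma alex_norm_cvg_uniform (U : R -> R -> R) (F : R -> R) :
  (forall t, 0 < t -> in_Bc (U t)) -> in_Bc F ->
  filterlim (fun t => alex_norm (fun x => U t x - F x)) (at_right 0) (Rbar_locally (Finite 0)) ->
  forall eps, 0 < eps -> exists d, 0 < d /\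
    forall t, 0 < t < d -> forall y, Rabs (U t y - F y) <= eps.
Proof.
intros HU HF Hlim eps Heps.
assert (H : at_right 0 (fun t => Rbar_le (alex_norm (fun x => U t x - F x)) eps)).
{ apply (Hlim (fun l => Rbar_le l eps)); simpl.
  exists (mkposreal eps Heps); intros y Hy.
  change (Rabs (y - 0) < eps) in Hy; rewrite Rminus_0_r in Hy.
  assert (K := Rle_abs y); lra. }
destruct H as [d Hd]; exists d; split; [apply cond_pos |].
intros t [Ht Htd] y.
apply (alex_norm_sup (fun y => U t y - F y)).
- replace (Finite 0) with (Finite (0 - 0)) by (f_equal; ring).
  apply (is_lim_minus' (U t) F); [apply HU | apply HF]; assumption.
- apply Hd; [| assumption].
  change (Rabs (t - 0) < d); rewrite Rminus_0_r, Rabs_pos_eq; lra.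
Qed.

Lemma in_Bc_bounded (F : R -> R) :
  in_Bc F -> exists M, 0 <= M /\ forall x, Rabs (F x) <= M.
Proof.
intros (Hc & Hm & L & Hp).
destruct (proj2 (is_lim_spec F m_infty 0) Hm (mkposreal 1 Rlt_0_1)) as [A HA].
destruct (proj2 (is_lim_spec F p_infty L) Hp (mkposreal 1 Rlt_0_1)) as [B HB].
simpl in HA, HB.
destruct (continuous_bounded F A B) as [M [HM0 HM]]; [auto |].
exists (M + 1 + Rabs L); assert (HL := Rabs_pos L); split; [lra |].
intros x.
destruct (Rlt_dec x A) as [H|H]; [| destruct (Rlt_dec B x) as [H'|H']].
- specialize (HA x H); rewrite Rminus_0_r in HA; lra.
- specialize (HB x H').
  replace (F x) with ((F x - L) + L) by ring.
  eapply Rle_trans; [apply Rabs_triang |]; lra.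
- specialize (HM x ltac:(lra)); lra.
Qed.

(** * Pairing with the truncated backward kernel *)

(** The form in which the distributional identity is applied: test functions in [elem], intervals
    centred at the origin, and the derivative given as an explicit function instead of [Derive]. *)
Definition weak_primitive (F g : R -> R) : Prop :=
  forall (phi phi' : R -> R) (r : R),
    0 < r -> elem phi -> supported_in phi (- r) r -> (forall z, is_derive phi z (phi' z)) ->
    RInt (fun z => g z * phi z) (- r) r = - RInt (fun z => F z * phi' z) (- r) r.

Lemma RInt_translate (f : R -> R) (x a b : R) :
  a <= b -> (forall z, continuous f z) ->
  RInt (fun z => f (x + z)) a b = RInt f (x + a) (x + b).
Proof.
intros Hab Hf.
assert (H := RInt_comp_lin f 1 x a b).
replace (1 * a + x) with (x + a) in H by ring.
replace (1 * b + x) with (x + b) in H by ring.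
rewrite <- H.
- apply RInt_ext; intros z _; unfold scal; simpl; unfold mult; simpl.
  rewrite Rmult_1_l; f_equal; ring.
- apply ex_RInt_continuous_on; [lra | auto].
Qed.

(** The test function is translated by [x] instead, so that [dist_deriv] applies to the untranslated
    pair; a change of variables brings the integrals back. *)
Lemma weak_primitive_translate (x : R) (F g : R -> R) :
  (forall z, continuous F z) -> (forall z, continuous g z) -> dist_deriv F g ->
  weak_primitive (fun z => F (x + z)) (fun z => g (x + z)).
Proof.
intros HF Hg HFg phi phi' r Hr He Hs Hd.
assert (He' : elem phi').
{ destruct (elem_derive phi He) as [f [E D]].
  apply (elem_ext f); [| exact E]; intros z.
  rewrite <- (is_derive_unique _ _ _ (D z)); apply (is_derive_unique _ _ _ (Hd z)). }
assert (Ht : forall f, elem f -> elem (fun y => f (y + - x))).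
{ intros f Hf; apply (elem_comp f); [exact Hf |].
  apply (elem_plus (fun y => y)); [apply elem_id | apply elem_const]. }
assert (H := HFg (fun y => phi (y + - x))).
specialize (H ltac:(split; [now apply elem_smooth, Ht | exists (x + - r), (x + r);
  intros y Hy; apply Hs; destruct Hy; [left | right]; lra])).
specialize (H (x + - r) (x + r) ltac:(lra)
  ltac:(intros y Hy; apply Hs; destruct Hy; [left | right]; lra)).
rewrite (RInt_ext _ (fun y => F y * phi' (y + - x))) in H.
- rewrite <- !RInt_translate in H.
  + rewrite (RInt_ext (fun z => g (x + z) * phi z) (fun z => g (x + z) * phi (x + z + - x))).
    * rewrite <- H; f_equal; apply RInt_ext; intros z _; do 2 f_equal; ring.
    * intros z _; do 2 f_equal; ring.
  + lra.
  + intros z; apply (continuous_mult (K := R_AbsRing)); [auto | now apply elem_continuous, Ht].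
  + lra.
  + intros z; apply (continuous_mult (K := R_AbsRing)); [auto | now apply elem_continuous, Ht].
- intros y _; f_equal; apply is_derive_unique.
  evar_last.
  + apply (is_derive_comp phi (fun y => y + - x)); [apply Hd |].
    auto_derive; [trivial | reflexivity].
  + apply Rmult_1_l.
Qed.

(** The data of a solution centred at the origin. Membership in the Alexiewicz space enters through
    [weak_primitive], the continuity of [W t] and a bound [M] uniform in time. *)
Definition heat_flow (w wz wzz wt W : R -> R -> R) (M : R) : Prop :=
  (forall z t, 0 < t -> is_derive (fun y => w y t) z (wz z t)) /\
  (forall z t, 0 < t -> is_derive (fun y => wz y t) z (wzz z t)) /\
  (forall z t, 0 < t -> is_derive (fun s => w z s) t (wt z t)) /\
  (forall z t, 0 < t ->
     continuous (fun p : R * R => w (fst p) (snd p)) (z, t) /\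
     continuous (fun p : R * R => wzz (fst p) (snd p)) (z, t) /\
     continuous (fun p : R * R => wt (fst p) (snd p)) (z, t)) /\
  (forall z t, 0 < t -> wt z t = wzz z t) /\
  (forall t, 0 < t -> weak_primitive (W t) (fun z => w z t)) /\
  (forall t z, 0 < t -> continuous (W t) z /\ Rabs (W t z) <= M).

Lemma is_derive_mult_R (f g : R -> R) (x df dg : R) :
  is_derive f x df -> is_derive g x dg ->
  is_derive (fun y => f y * g y) x (df * g x + f x * dg).
Proof. intros Hf Hg; apply (is_derive_mult f g); auto; intros; apply Rmult_comm. Qed.

Lemma continuous_swap (k : R -> R -> R) (z s : R) :
  continuous (fun p : R * R => k (fst p) (snd p)) (z, s) ->
  continuous (fun p : R * R => k (snd p) (fst p)) (s, z).
Proof.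
intros H; apply (continuous_comp_2 snd fst k);
  [apply continuous_snd | apply continuous_fst | exact H].
Qed.

(** The expression is the [z]-derivative of the commutator [2 * Theta_z * chi1 + Theta * chi2].
    Matching weights bound each product by [40 * K], and the coefficients add up to
    [2 + 3 + 1 = 6]. *)
Lemma kernel_defect_bound (r K t z : R) (chi chi1 chi2 chi3 : R -> R) :
  is_cutoff r K chi chi1 chi2 chi3 -> 0 < t -> 0 <= K -> Rabs z <= r ->
  Rabs (2 * Theta_zz t z * chi1 z + 3 * Theta_z t z * chi2 z + Theta t z * chi3 z) <= 240 * K.
Proof.
intros (_ & _ & _ & _ & _ & _ & Hb) Ht HK Hz.
destruct (Hb z Hz) as (_ & B1 & B2 & B3).
destruct (Theta_bounds t z Ht) as (T0 & T1 & T2 & _).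
assert (Hp : forall a b c d, 0 <= a -> 0 <= c -> b <= K * d -> d * a <= 40 -> a * b <= 40 * K)
  by (intros; nra).
assert (HT := Theta_pos t z Ht).
eapply Rle_trans; [apply Rabs_triang |].
eapply Rle_trans; [apply Rplus_le_compat_r, Rabs_triang |].
rewrite !Rabs_mult, (Rabs_pos_eq 2), (Rabs_pos_eq 3), (Rabs_pos_eq (Theta t z)) by lra.
assert (Q1 := Hp (Rabs (Theta_zz t z)) _ 0 _ (Rabs_pos _) (Rle_refl 0) B1 T2).
assert (Q2 := Hp (Rabs (Theta_z t z)) _ 0 _ (Rabs_pos _) (Rle_refl 0) B2 T1).
assert (Q3 := Hp (Theta t z) _ 0 _ (Rlt_le _ _ HT) (Rle_refl 0) B3 T0).
lra.
Qed.

Lemma heat_pairing_derive (w wz wzz wt W : R -> R -> R) (M r K T s : R)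
    (chi chi1 chi2 chi3 : R -> R) :
  heat_flow w wz wzz wt W M -> is_cutoff r K chi chi1 chi2 chi3 -> 0 < r ->
  0 < s < T ->
  is_derive (fun s => RInt (fun z => w z s * (Theta (T - s) z * chi z)) (- r) r) s
    (- RInt (fun z => W s z * (2 * Theta_zz (T - s) z * chi1 z
        + 3 * Theta_z (T - s) z * chi2 z + Theta (T - s) z * chi3 z)) (- r) r).
Proof.
intros (Dz & Dzz & Dt & Hc & Heq & HW & _) ((E0 & E1 & E2 & E3) & D1 & D2 & D3 & Hs & _) Hr [Hs0 HsT].
assert (Hpos : 0 < T - s) by lra.
assert (Hs1 := supported_in_derive _ _ _ _ Hs D1).
assert (Hs2 := supported_in_derive _ _ _ _ Hs1 D2).
assert (Hder : forall s' z, 0 < s' < T ->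
  is_derive (fun s => w z s * (Theta (T - s) z * chi z)) s'
    (wt z s' * (Theta (T - s') z * chi z) + w z s' * (- Theta_zz (T - s') z * chi z))).
{ intros s' z [H1 H2]; 
  apply (is_derive_mult_R (fun s => w z s) (fun s => Theta (T - s) z * chi z)); [now apply Dt |].
  evar_last.
  - apply (is_derive_mult_R (fun s => Theta (T - s) z) (fun _ => chi z)).
    + apply (is_derive_comp (fun t => Theta t z) (fun s => T - s)).
      * apply is_derive_Theta_time; lra.
      * auto_derive; [trivial | reflexivity].
    + exact (is_derive_const (K := R_AbsRing) (V := R_NormedModule) (chi z) s').
  - unfold scal, zero; simpl; unfold mult; simpl; ring. }
assert (Hball : locally s (fun s' => 0 < s' < T)).
{ apply (filter_and (F := locally s)); [now apply open_gt | now apply open_lt]. }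
assert (Hsw : forall f, elem f -> forall p : R * R, continuous (fun p : R * R => f (snd p)) p).
{ intros f Hf [p q]; apply (continuous_comp snd f); [apply continuous_snd | now apply elem_continuous]. }
assert (HTs : forall p : R * R, continuous (fun p : R * R => T - fst p) p).
{ intros [p q]; apply (continuous_minus (V := R_NormedModule));
    [apply continuous_const | apply continuous_fst]. }
assert (Hw1 : forall s' z, 0 < s' -> continuous (fun z => w z s') z).
{ intros s' z H; apply (ex_derive_continuous (fun z => w z s')); eexists; now apply Dz. }
set (Phi := fun z => Theta (T - s) z * chi z).
set (Phi1 := fun z => Theta_z (T - s) z * chi z + Theta (T - s) z * chi1 z).
(* The commutator: the second derivative of [Phi] is [Theta_zz * chi + Q], while the backward kernel
   contributes only [Theta_zz * chi]. *)
set (Q := fun z => 2 * Theta_z (T - s) z * chi1 z + Theta (T - s) z * chi2 z).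
assert (EQ : elem Q).
{ apply (elem_plus (fun z => 2 * Theta_z (T - s) z * chi1 z)
    (fun z => Theta (T - s) z * chi2 z)).
  - apply (elem_mult (fun z => 2 * Theta_z (T - s) z)); [apply elem_scal, elem_Theta_z | assumption].
  - apply elem_mult; [apply elem_Theta | assumption]. }
evar_last.
- apply (is_derive_RInt_param (fun s z => w z s * (Theta (T - s) z * chi z))).
  + revert Hball; apply filter_imp; intros s' H' z _; eexists; now apply Hder.
  + intros z _.
    (* The formula for the time derivative is available only for times in [(0, T)], hence the local
       form of extensionality. *)
    apply (continuity_2d_pt_ext_loc (fun s z => wt z s * (Theta (T - s) z * chi z)
       + w z s * (- Theta_zz (T - s) z * chi z))).
    { destruct Hball as [d Hd]; exists d; intros u v Hu _; symmetry.
      apply is_derive_unique, Hder, Hd, Hu. }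
    apply continuity_2d_pt_filterlim.
    destruct (Hc z s Hs0) as (C1 & C2 & C3).
    apply (continuous_plus (V := R_NormedModule)
      (fun p : R * R => wt (snd p) (fst p) * (Theta (T - fst p) (snd p) * chi (snd p)))
      (fun p : R * R => w (snd p) (fst p) * (- Theta_zz (T - fst p) (snd p) * chi (snd p))));
    apply (continuous_mult (K := R_AbsRing));
      try (now apply (continuous_swap wt)); try (now apply (continuous_swap w));
    apply (continuous_mult (K := R_AbsRing)); auto.
    * apply continuous_Theta; simpl; auto using continuous_snd.
    * apply (continuous_opp (V := R_NormedModule)).
      apply continuous_Theta_zz; simpl; auto using continuous_snd.
  + revert Hball; apply filter_imp; intros s' H'.
    apply ex_RInt_continuous_on; [lra |]; intros z _.
    apply (continuous_mult (K := R_AbsRing)); [now apply Hw1 |].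
    apply elem_continuous, elem_mult; [apply elem_Theta | assumption].
- rewrite <- (HW s Hs0 Q); auto.
  + assert (HPhi : forall z, is_derive Phi z (Phi1 z)).
    { intros z; apply is_derive_mult_R; [now apply is_derive_Theta | apply D1]. }
    assert (HPhi1 : forall z, is_derive Phi1 z (Theta_zz (T - s) z * chi z + Q z)).
    { intros z; evar_last.
      - apply (is_derive_plus (fun z => Theta_z (T - s) z * chi z)
          (fun z => Theta (T - s) z * chi1 z)); apply is_derive_mult_R;
          auto using is_derive_Theta, is_derive_Theta_z.
      - unfold plus; simpl; unfold Q; ring. }
    destruct (supported_in_bounds chi (- r) r) as [X1 X2];
      [intros; now apply elem_continuous | assumption |].
    destruct (supported_in_bounds chi1 (- r) r) as [Y1 Y2];
      [intros; now apply elem_continuous | assumption |].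
    assert (EZ : forall z, continuous (Theta_zz (T - s)) z).
    { intros z; apply elem_continuous, elem_Theta_zz. }
    assert (EP : forall z, continuous Phi z).
    { intros z; apply elem_continuous, elem_mult; [apply elem_Theta | assumption]. }
    assert (Hwzz : forall z, continuous (fun z => wzz z s) z).
    { intros z; apply continuity_2d_pt_slice, continuity_2d_pt_filterlim, (Hc z s Hs0). }
    (* Green's identity: the integrand is the derivative of [wz * Phi - w * Phi1], whose boundary
       values vanish because [chi] and [chi1] vanish at both endpoints. *)
    assert (HI : is_RInt (fun z => wzz z s * Phi z - w z s * (Theta_zz (T - s) z * chi z + Q z))
       (- r) r 0).
    { evar_last.
      - apply (is_RInt_derive (fun z => wz z s * Phi z - w z s * Phi1 z)).
        + intros z _; evar_last.
          * apply (is_derive_minus (fun z => wz z s * Phi z) (fun z => w z s * Phi1 z));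
              apply is_derive_mult_R; eauto.
          * unfold minus, plus, opp; simpl; ring.
        + intros z _; apply (continuous_minus (V := R_NormedModule));
            apply (continuous_mult (K := R_AbsRing)); auto.
          apply (continuous_plus (V := R_NormedModule)); [| now apply elem_continuous].
          apply (continuous_mult (K := R_AbsRing)); [auto | now apply elem_continuous].
      - unfold Phi, Phi1; rewrite X1, X2, Y1, Y2.
        unfold minus, plus, opp; simpl; ring. }
    assert (HJ : ex_RInt (fun z => w z s * Q z) (- r) r).
    { apply ex_RInt_continuous_on; [lra |]; intros z _.
      apply (continuous_mult (K := R_AbsRing)); [auto | now apply elem_continuous]. }
    assert (H2 := is_RInt_plus (V := R_NormedModule) _ _ _ _ _ _ HI
      (RInt_correct (V := R_CompleteNormedModule) _ _ _ HJ)).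
    assert (H3 := is_RInt_unique (V := R_CompleteNormedModule) _ _ _ _ H2).
    change (RInt (fun z => (wzz z s * Phi z - w z s * (Theta_zz (T - s) z * chi z + Q z))
      + w z s * Q z) (- r) r = 0 + RInt (fun z => w z s * Q z) (- r) r) in H3.
    rewrite Rplus_0_l in H3; rewrite <- H3.
    apply RInt_ext; intros z _.
    etransitivity; [exact (is_derive_unique _ _ _ (Hder s z (conj Hs0 HsT))) |].
    rewrite (Heq z s Hs0); unfold Phi.
    match goal with |- ?a = ?b => change (@eq R a b) end; ring.
  + intros z Hz; unfold Q; rewrite Hs1, Hs2 by assumption; ring.
  + intros z; evar_last.
    * apply (is_derive_plus (fun z => 2 * Theta_z (T - s) z * chi1 z)
          (fun z => Theta (T - s) z * chi2 z)); apply is_derive_mult_R;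
        auto using is_derive_Theta.
      apply (is_derive_scal (Theta_z (T - s)) z 2); now apply is_derive_Theta_z.
    * unfold plus; simpl; ring.
Qed.

(** The bound is the length [2 * r] times [M * (240 * K)] times the elapsed time. The pairing is
    singular at [s = T], so the mean value theorem is applied up to [T - t], and the approximate
    identity covers the remaining gap. *)
Lemma heat_representation (w wz wzz wt W : R -> R -> R) (M r K T s : R)
    (chi chi1 chi2 chi3 : R -> R) :
  heat_flow w wz wzz wt W M -> is_cutoff r K chi chi1 chi2 chi3 -> 0 < r -> 0 <= K ->
  0 < s < T ->
  Rabs (w 0 T + RInt (fun z => W s z *
     (Theta_z (T - s) z * chi z + Theta (T - s) z * chi1 z)) (- r) r)
    <= 480 * K * M * r * (T - s).
Proof.
intros Hw Hchi Hr HK HsT.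
assert (HD := fun s' => heat_pairing_derive _ _ _ _ _ _ _ _ T s' _ _ _ _ Hw Hchi Hr).
assert (HB := fun t z Ht => kernel_defect_bound r K t z _ _ _ _ Hchi Ht HK).
destruct Hw as (Dz & Dzz & Dt & Hc & Heq & HW & HM).
destruct Hchi as ((E0 & E1 & E2 & E3) & D1 & D2 & D3 & Hs & H0 & _).
set (J := fun s => RInt (fun z => w z s * (Theta (T - s) z * chi z)) (- r) r) in *.
assert (HM0 : 0 <= M).
{ destruct (HM s 0 (proj1 HsT)) as [_ H]; assert (A := Rabs_pos (W s 0)); lra. }
assert (HJs : J s = - RInt (fun z => W s z *
     (Theta_z (T - s) z * chi z + Theta (T - s) z * chi1 z)) (- r) r).
{ apply (HW s (proj1 HsT)); auto.
  - apply elem_mult; [apply elem_Theta | assumption].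
  - intros z Hz; rewrite Hs by assumption; ring.
  - intros z; apply is_derive_mult_R; [apply is_derive_Theta; lra | apply D1]. }
replace (RInt _ _ _) with (- J s) by (rewrite HJs; ring).
apply le_epsilon; intros eps Heps.
(* As [chi 0 = 1], the limit of the pairing is [w 0 T] itself. *)
destruct (Theta_approx_identity (fun z s => w z s * chi z) r T Hr ltac:(lra)) with (eps := eps)
  as [d [Hd0 Hd]]; [| exact Heps |].
{ intros z s' Hz Hs'; apply continuity_2d_pt_mult.
  - apply continuity_2d_pt_filterlim, Hc; lra.
  - apply continuity_2d_pt_filterlim.
    apply (continuous_comp fst chi (z, s')); [apply continuous_fst | now apply elem_continuous]. }
set (t := Rmin (d / 2) ((T - s) / 2)).
assert (Ht : 0 < t) by (apply Rmin_pos; lra).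
assert (Htd : t <= d / 2) by apply Rmin_l.
assert (HtT : t <= (T - s) / 2) by apply Rmin_r.
specialize (Hd t ltac:(lra)).
rewrite H0, Rmult_1_r in Hd.
replace (RInt _ _ _) with (J (T - t)) in Hd.
2: { apply RInt_ext; intros z _; replace (T - (T - t)) with t by ring.
     match goal with |- ?a = ?b => change (@eq R a b) end; ring. }
destruct (MVT_gen J s (T - t) (fun s => - RInt (fun z => W s z * (2 * Theta_zz (T - s) z * chi1 z
        + 3 * Theta_z (T - s) z * chi2 z + Theta (T - s) z * chi3 z)) (- r) r)) as [c [Hc1 Hc2]].
- rewrite Rmin_left, Rmax_right by lra; intros s' Hs'; apply HD; lra.
- rewrite Rmin_left, Rmax_right by lra; intros s' Hs'.
  apply continuity_pt_filterlim, (ex_derive_continuous J); eexists; apply HD; lra.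
- rewrite Rmin_left, Rmax_right in Hc1 by lra.
  assert (HI : Rabs (RInt (fun z => W c z * (2 * Theta_zz (T - c) z * chi1 z
        + 3 * Theta_z (T - c) z * chi2 z + Theta (T - c) z * chi3 z)) (- r) r)
      <= (r - - r) * (M * (240 * K))).
  { apply abs_RInt_le_const; [lra | |].
    - apply ex_RInt_continuous_on; [lra |]; intros z _.
      apply (continuous_mult (K := R_AbsRing)); [apply HM; lra |].
      apply elem_continuous.
      apply (elem_plus (fun z => 2 * Theta_zz (T - c) z * chi1 z + 3 * Theta_z (T - c) z * chi2 z)
        (fun z => Theta (T - c) z * chi3 z));
        [apply (elem_plus (fun z => 2 * Theta_zz (T - c) z * chi1 z)
           (fun z => 3 * Theta_z (T - c) z * chi2 z)) |].
      + apply (elem_mult (fun z => 2 * Theta_zz (T - c) z));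
          [apply elem_scal, elem_Theta_zz | assumption].
      + apply (elem_mult (fun z => 3 * Theta_z (T - c) z));
          [apply elem_scal, elem_Theta_z | assumption].
      + apply elem_mult; [apply elem_Theta | assumption].
    - intros z Hz; rewrite Rabs_mult; apply Rmult_le_compat; auto using Rabs_pos.
      + apply HM; lra.
      + apply HB; [lra | apply Rabs_le; lra]. }
  replace (w 0 T + - J s) with ((J (T - t) - J s) + - (J (T - t) - w 0 T)) by ring.
  eapply Rle_trans; [apply Rabs_triang |].
  rewrite Rabs_Ropp; apply Rplus_le_compat; [| exact Hd].
  rewrite Hc2, Rabs_mult, Rabs_Ropp, (Rabs_pos_eq (T - t - s)) by lra.
  replace (480 * K * M * r * (T - s)) with ((r - - r) * (M * (240 * K)) * (T - s)) by ring.
  apply Rmult_le_compat; [apply Rabs_pos | lra | exact HI | lra].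
Qed.

(** * Letting the initial time tend to 0 and removing the cutoff *)

Lemma RInt_sub (f g : R -> R) (a b : R) :
  ex_RInt f a b -> ex_RInt g a b ->
  RInt (fun z => f z - g z) a b = RInt f a b - RInt g a b.
Proof. exact (RInt_minus (V := R_CompleteNormedModule) f g a b). Qed.

Lemma heat_representation_initial (w wz wzz wt W : R -> R -> R) (F : R -> R) (M r K t : R)
    (chi chi1 chi2 chi3 : R -> R) :
  heat_flow w wz wzz wt W M -> is_cutoff r K chi chi1 chi2 chi3 -> 0 < r -> 0 <= K ->
  0 < t -> (forall z, continuous F z) ->
  (forall eps, 0 < eps -> exists d, 0 < d /\
     forall s, 0 < s < d -> forall z, Rabs (W s z - F z) <= eps) ->
  Rabs (w 0 t + RInt (fun z => F z * (Theta_z t z * chi z + Theta t z * chi1 z)) (- r) r)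
    <= 480 * K * M * r * t.
Proof.
intros Hw Hchi Hr HK Ht HF Hcvg.
(* The final time [t + s] moves with [s], so the kernel is always taken at time [t] and stays fixed.
   Only [W s], which converges uniformly to [F], and [w 0 (t + s)], which tends to [w 0 t], still
   depend on [s]. *)
assert (HR := fun s Hs => heat_representation _ _ _ _ _ _ _ _ (t + s) s _ _ _ _ Hw Hchi Hr HK Hs).
destruct Hw as (_ & _ & Dt & _ & _ & _ & HM).
destruct Hchi as ((E0 & E1 & _) & _).
set (P := fun z => Theta_z t z * chi z + Theta t z * chi1 z) in *.
assert (EP : elem P).
{ apply (elem_plus (fun z => Theta_z t z * chi z) (fun z => Theta t z * chi1 z));
    apply elem_mult; auto using elem_Theta, elem_Theta_z. }
destruct (elem_bounded P (- r) r EP) as [B HB].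
assert (HB0 : 0 <= B) by (assert (A := HB 0 ltac:(lra)); assert (A' := Rabs_pos (P 0)); lra).
assert (HexF : ex_RInt (fun z => F z * P z) (- r) r).
{ apply ex_RInt_continuous_on; [lra |]; intros z _.
  apply (continuous_mult (K := R_AbsRing)); [auto | now apply elem_continuous]. }
apply le_epsilon; intros eps Heps.
(* The closeness required of the primitives, as the integral runs over length [2 * r] with weight at
   most [B]; the added 1 keeps the denominator positive when [B = 0]. *)
set (eta := eps / 2 / (2 * r * B + 1)).
assert (HrB : 0 <= 2 * r * B) by (apply Rmult_le_pos; lra).
assert (Heta : 0 < eta) by (apply Rdiv_lt_0_compat; lra).
destruct (Hcvg eta Heta) as [d1 [Hd1 Hd1']].
assert (Hwc : continuous (fun s => w 0 s) t).
{ apply (ex_derive_continuous (fun s => w 0 s)); eexists; now apply Dt. }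
assert (He2 : 0 < eps / 2) by lra.
destruct (proj1 (filterlim_locally _ _) Hwc (mkposreal _ He2)) as [d2 Hd2].
assert (Hd2p := cond_pos d2).
set (s := Rmin d1 d2 / 2).
assert (Hs : 0 < Rmin d1 d2) by (apply Rmin_pos; lra).
assert (Hs1 : Rmin d1 d2 <= d1) by apply Rmin_l.
assert (Hs2 : Rmin d1 d2 <= d2) by apply Rmin_r.
assert (Hs0 : 0 < s) by (unfold s; lra).
specialize (HR s ltac:(lra)).
replace (t + s - s) with t in HR by ring; fold P in HR.
specialize (Hd1' s ltac:(unfold s; lra)).
specialize (Hd2 (t + s)).
assert (Hd2' : Rabs (w 0 (t + s) - w 0 t) < eps / 2).
{ apply Hd2; change (Rabs (t + s - t) < d2).
  replace (t + s - t) with s by ring; rewrite Rabs_pos_eq; unfold s; lra. }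
assert (HexW : ex_RInt (fun z => W s z * P z) (- r) r).
{ apply ex_RInt_continuous_on; [lra |]; intros z _.
  apply (continuous_mult (K := R_AbsRing)); [now apply HM | now apply elem_continuous]. }
assert (Hdiff : Rabs (RInt (fun z => W s z * P z) (- r) r - RInt (fun z => F z * P z) (- r) r)
  <= eps / 2).
{ rewrite <- (RInt_sub _ _ _ _ HexW HexF).
  apply Rle_trans with ((r - - r) * (eta * B)).
  - apply abs_RInt_le_const; [lra | |].
    + exact (ex_RInt_minus (V := R_NormedModule) _ _ _ _ HexW HexF).
    + intros z Hz; change (Rabs (W s z * P z - F z * P z) <= eta * B).
      rewrite <- Rmult_minus_distr_r, Rabs_mult.
      apply Rmult_le_compat; auto using Rabs_pos.
  - replace (eps / 2) with (eta * (2 * r * B + 1)) by (unfold eta; field; lra). nra. }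
replace (w 0 t + _) with ((w 0 (t + s) + RInt (fun z => W s z * P z) (- r) r)
  + (- (w 0 (t + s) - w 0 t)
  + - (RInt (fun z => W s z * P z) (- r) r - RInt (fun z => F z * P z) (- r) r))).
2: { change (fun z => F z * (Theta_z t z * chi z + Theta t z * chi1 z))
       with (fun z => F z * P z); ring. }
eapply Rle_trans; [apply Rabs_triang |]; apply Rplus_le_compat; [exact HR |].
eapply Rle_trans; [apply Rabs_triang |]; rewrite !Rabs_Ropp; lra.
Qed.

(** The two integrands differ by [F] times [- Theta_z * (1 - chi) + Theta * chi1]. The time-weighted
    kernel bounds make each summand at most [80 * K * t], on an interval of length [2 * r]. *)
Lemma cutoff_removal (F : R -> R) (N r K t : R) (chi chi1 chi2 chi3 : R -> R) :
  is_cutoff r K chi chi1 chi2 chi3 -> 0 < r -> 0 <= K -> 0 < t ->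
  (forall z, continuous F z) -> (forall z, Rabs (F z) <= N) ->
  Rabs (RInt (fun z => F z * (Theta_z t z * chi z + Theta t z * chi1 z)) (- r) r
        - RInt (fun z => F z * Theta_z t z) (- r) r) <= 320 * N * K * r * t.
Proof.
intros ((E0 & E1 & _) & _ & _ & _ & _ & _ & Hb) Hr HK Ht HF HN.
assert (HexF : forall f, elem f -> ex_RInt (fun z => F z * f z) (- r) r).
{ intros f Hf; apply ex_RInt_continuous_on; [lra |]; intros z _.
  apply (continuous_mult (K := R_AbsRing)); [auto | now apply elem_continuous]. }
assert (EP : elem (fun z => Theta_z t z * chi z + Theta t z * chi1 z)).
{ apply (elem_plus (fun z => Theta_z t z * chi z) (fun z => Theta t z * chi1 z));
    apply elem_mult; auto using elem_Theta, elem_Theta_z. }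
assert (H1 := HexF _ EP); assert (H2 := HexF _ (elem_Theta_z t)).
rewrite <- (RInt_sub _ _ _ _ H1 H2).
replace (320 * N * K * r * t) with ((r - - r) * (N * (160 * K * t))) by ring.
apply abs_RInt_le_const; [lra | |].
- exact (ex_RInt_minus (V := R_NormedModule) _ _ _ _ H1 H2).
- intros z Hz.
  change (Rabs (F z * (Theta_z t z * chi z + Theta t z * chi1 z) - F z * Theta_z t z)
    <= N * (160 * K * t)).
  replace (F z * (Theta_z t z * chi z + Theta t z * chi1 z) - F z * Theta_z t z)
    with (F z * (- (Theta_z t z * (1 - chi z)) + Theta t z * chi1 z)) by ring.
  rewrite Rabs_mult; apply Rmult_le_compat; auto using Rabs_pos.
  destruct (Hb z ltac:(apply Rabs_le; lra)) as (B0 & B1 & _).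
  destruct (Theta_bounds t z Ht) as (_ & _ & _ & T0 & T1).
  assert (HT := Theta_pos t z Ht).
  eapply Rle_trans; [apply Rabs_triang |].
  rewrite Rabs_Ropp, !Rabs_mult, (Rabs_pos_eq (Theta t z)) by lra.
  assert (Hp : forall a b d, 0 <= a -> b <= K * d -> d * a <= 80 * t -> a * b <= K * (80 * t))
    by (intros; nra).
  assert (Q1 := Hp _ _ _ (Rabs_pos _) B0 T1).
  assert (Q2 := Hp _ _ _ (Rlt_le _ _ HT) B1 T0).
  lra.
Qed.

(** Both errors carry [K * r] with [K = C / r ^ 4], hence are of order [r ^ -3]; since [1 <= r] they
    relax to order [1 / r], the order of the tails treated next. *)
Lemma heat_symmetric_integral (w wz wzz wt W : R -> R -> R) (F : R -> R) (M N t : R) :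
  heat_flow w wz wzz wt W M -> 0 < t ->
  (forall z, continuous F z) -> (forall z, Rabs (F z) <= N) ->
  (forall eps, 0 < eps -> exists d, 0 < d /\
     forall s, 0 < s < d -> forall z, Rabs (W s z - F z) <= eps) ->
  exists A, forall r, 1 <= r ->
    Rabs (RInt (fun z => F z * Theta_z t z) (- r) r - - w 0 t) <= A / r.
Proof.
intros Hw Ht HF HN Hcvg.
assert (HM : 0 <= M).
{ destruct Hw as (_ & _ & _ & _ & _ & _ & H); destruct (H t 0 Ht) as [_ H'].
  assert (A := Rabs_pos (W t 0)); lra. }
assert (HN0 : 0 <= N) by (assert (A := Rabs_pos (F 0)); specialize (HN 0); lra).
destruct cutoff_exists as [C [HC Hcut]].
exists ((480 * M + 320 * N) * C * t); intros r Hr.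
destruct (Hcut r ltac:(lra)) as (chi & chi1 & chi2 & chi3 & Hchi).
assert (Hr4 : 0 < / r ^ 4) by (apply Rinv_0_lt_compat, pow_lt; lra).
assert (HK : 0 <= C / r ^ 4) by (apply Rmult_le_pos; lra).
assert (H1 := heat_representation_initial _ _ _ _ _ F _ _ _ t _ _ _ _ Hw Hchi ltac:(lra) HK Ht HF Hcvg).
assert (H2 := cutoff_removal F N _ _ t _ _ _ _ Hchi ltac:(lra) HK Ht HF HN).
set (I1 := RInt (fun z => F z * (Theta_z t z * chi z + Theta t z * chi1 z)) (- r) r) in *.
set (I2 := RInt (fun z => F z * Theta_z t z) (- r) r) in *.
replace (I2 - - w 0 t) with ((w 0 t + I1) + - (I1 - I2)) by ring.
eapply Rle_trans; [apply Rabs_triang |]; rewrite Rabs_Ropp.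
eapply Rle_trans; [apply Rplus_le_compat; [exact H1 | exact H2] |].
replace (480 * (C / r ^ 4) * M * r * t + 320 * N * (C / r ^ 4) * r * t)
  with ((480 * M + 320 * N) * C * t * / r ^ 3) by (field; lra).
apply Rmult_le_compat_l.
- apply Rmult_le_pos; [apply Rmult_le_pos |]; lra.
- apply Rinv_le_contravar; [lra |].
  assert (1 <= r ^ 2) by (assert (A := pow_incr 1 r 2 ltac:(lra)); rewrite pow1 in A; lra).
  replace (r ^ 3) with (r ^ 2 * r) by ring; nra.
Qed.

(** * From symmetric integrals to the improper integral *)

Lemma RInt_inv_sq_tail (g : R -> R) (D a b : R) :
  a <= b -> 0 < a \/ b < 0 -> (forall z, continuous g z) ->
  (forall z, z ^ 2 * Rabs (g z) <= D) -> Rabs (RInt g a b) <= D / a - D / b.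
Proof.
intros Hab H0 Hg HD.
assert (Hz : forall z, a <= z <= b -> z <> 0) by (intros z Hz; destruct H0; lra).
assert (H : is_RInt (fun z => D / z ^ 2) a b (- D / b - - D / a)).
{ apply (is_RInt_derive (fun z => - D / z)); rewrite Rmin_left, Rmax_right by lra;
    intros z Hzz; specialize (Hz z Hzz).
  - auto_derive; [trivial | field; trivial].
  - apply (ex_derive_continuous (fun z => D / z ^ 2)); auto_derive.
    rewrite Rmult_1_r; now apply Rmult_integral_contrapositive. }
replace (D / a - D / b) with (- D / b - - D / a) by (unfold Rdiv; ring).
apply (norm_RInt_le g (fun z => D / z ^ 2) a b); auto.
- intros z Hzz; specialize (Hz z Hzz).
  assert (Hz2 : 0 < z ^ 2) by (assert (A := pow2_ge_0 z); assert (B := pow_nonzero z 2 Hz); lra).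
  change (Rabs (g z) <= D / z ^ 2).
  apply (Rmult_le_reg_l (z ^ 2)); [exact Hz2 |].
  replace (z ^ 2 * (D / z ^ 2)) with D by (field; exact Hz); apply HD.
- apply (RInt_correct (V := R_CompleteNormedModule)), ex_RInt_continuous_on; auto.
Qed.

(** Symmetric integrals alone give a principal value. Quadratic decay controls the two leftover
    pieces, so the endpoints may tend to infinity independently; the shift by [x] undoes the
    centring. *)
Lemma is_RInt_gen_of_symmetric (g : R -> R) (x A D l : R) :
  (forall z, continuous g z) -> (forall z, z ^ 2 * Rabs (g z) <= D) ->
  (forall r, 1 <= r -> Rabs (RInt g (- r) r - l) <= A / r) ->
  is_RInt_gen (fun y => g (y - x)) (Rbar_locally m_infty) (Rbar_locally p_infty) l.
Proof.
intros Hg HD HA P [eps HP].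
assert (Heps := cond_pos eps).
assert (HD0 : 0 <= D) by (specialize (HD 0); rewrite pow_i, Rmult_0_l in HD by lia; exact HD).
assert (HA0 : 0 <= A).
{ assert (K := HA 1 ltac:(lra)); rewrite Rdiv_1_r in K.
  eapply Rle_trans; [apply Rabs_pos | exact K]. }
(* [A / r] bounds the symmetric defect and [D / r] each tail; the added 1 makes the final inequality
   strict and ensures [1 <= r]. *)
set (r := (A + 2 * D) / eps + 1).
assert (Hr : 1 <= r).
{ assert (0 <= (A + 2 * D) / eps); [| unfold r; lra].
  apply Rmult_le_pos; [lra | left; now apply Rinv_0_lt_compat]. }
assert (Hr' : (A + 2 * D) / r < eps).
{ apply (Rmult_lt_reg_r r); [lra |].
  replace ((A + 2 * D) / r * r) with (A + 2 * D) by (field; lra).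
  unfold r; rewrite Rmult_plus_distr_l.
  replace (eps * ((A + 2 * D) / eps)) with (A + 2 * D) by (field; lra); lra. }
apply (Filter_prod _ _ _ (fun a => a < x - r) (fun b => x + r < b)).
- now exists (x - r).
- now exists (x + r).
- intros a b Ha Hb; simpl.
  assert (Hex : forall c d, ex_RInt g c d)
    by (intros; apply (@ex_RInt_continuous R_CompleteNormedModule); auto).
  exists (RInt g (a - x) (b - x)); split.
  + apply (is_RInt_ext (fun y => scal 1 (g (1 * y + - x)))).
    * intros y _; unfold scal; simpl; unfold mult; simpl.
      rewrite Rmult_1_l; f_equal; ring.
    * apply (is_RInt_comp_lin (V := R_NormedModule) g 1 (- x) a b).
      replace (1 * a + - x) with (a - x) by ring; replace (1 * b + - x) with (b - x) by ring.
      apply (RInt_correct (V := R_CompleteNormedModule)), Hex.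
  + apply HP; change (Rabs (RInt g (a - x) (b - x) - l) < eps).
    assert (E : RInt g (a - x) (b - x)
      = RInt g (a - x) (- r) + (RInt g (- r) r + RInt g r (b - x))).
    { rewrite <- (RInt_Chasles (V := R_CompleteNormedModule) g (a - x) (- r) (b - x)) by auto.
      rewrite <- (RInt_Chasles (V := R_CompleteNormedModule) g (- r) r (b - x)) by auto.
      reflexivity. }
    rewrite E.
    assert (T1 := RInt_inv_sq_tail g D (a - x) (- r) ltac:(lra) ltac:(lra) Hg HD).
    assert (T2 := RInt_inv_sq_tail g D r (b - x) ltac:(lra) ltac:(lra) Hg HD).
    assert (K := HA r Hr).
    assert (S1 : D / (a - x) <= 0).
    { assert (/ (a - x) < 0) by (apply Rinv_lt_0_compat; lra); unfold Rdiv; nra. }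
    assert (S2 : 0 <= D / (b - x)).
    { apply Rmult_le_pos; [lra | left; apply Rinv_0_lt_compat; lra]. }
    replace (D / - r) with (- (D / r)) in T1 by (field; lra).
    replace ((A + 2 * D) / r) with (A / r + 2 * (D / r)) in Hr' by (field; lra).
    replace (_ - l) with (RInt g (a - x) (- r) + ((RInt g (- r) r - l) + RInt g r (b - x))) by ring.
    eapply Rle_lt_trans; [apply Rabs_triang |].
    eapply Rle_lt_trans; [apply Rplus_le_compat_l, Rabs_triang |].
    lra.
Qed.

(** Gives the value 0 of [h] at infinity in [pair_Ac]. The rough bound of [|z| * Theta] by 40
    already yields the decay. *)
Lemma is_lim_Theta_reflected (t x : R) :
  0 < t -> is_lim (fun y => Theta t (x - y)) p_infty 0.
Proof.
intros Ht; apply is_lim_spec; intros eps; assert (He := cond_pos eps).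
exists (x + 40 / eps); intros y Hy; rewrite Rminus_0_r.
assert (HT := Theta_pos t (x - y) Ht); rewrite Rabs_pos_eq by lra.
destruct (Theta_bounds t (x - y) Ht) as [B _].
assert (H40 : 0 < 40 / eps) by (apply Rdiv_lt_0_compat; lra).
rewrite Rabs_left in B by lra.
destruct (Rlt_dec (Theta t (x - y)) eps) as [H|H]; [exact H | exfalso].
assert (40 / eps * eps = 40) by (field; lra).
nra.
Qed.

Lemma heat_flow_translate (u ux uxx ut : R -> R -> R) (U : R -> R -> R) (M x : R) :
  (forall x t, 0 < t -> is_derive (fun y => u y t) x (ux x t)) ->
  (forall x t, 0 < t -> is_derive (fun y => ux y t) x (uxx x t)) ->
  (forall x t, 0 < t -> is_derive (fun s => u x s) t (ut x t)) ->
  (forall x t, 0 < t ->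
     continuous (fun p : R * R => u (fst p) (snd p)) (x, t) /\
     continuous (fun p : R * R => ux (fst p) (snd p)) (x, t) /\
     continuous (fun p : R * R => uxx (fst p) (snd p)) (x, t) /\
     continuous (fun p : R * R => ut (fst p) (snd p)) (x, t)) ->
  (forall x t, 0 < t -> ut x t - uxx x t = 0) ->
  (forall t, 0 < t -> Ac_primitive (fun x => u x t) (U t)) ->
  (forall t, 0 < t -> Rbar_le (alex_norm (U t)) (Finite M)) ->
  heat_flow (fun z => u (x + z)) (fun z => ux (x + z)) (fun z => uxx (x + z))
    (fun z => ut (x + z)) (fun t z => U t (x + z)) M.
Proof.
intros Dx Dxx Dt Hc Heq HU HM.
assert (Htr : forall f f' : R -> R, (forall y, is_derive f y (f' y)) ->
  forall z, is_derive (fun z => f (x + z)) z (f' (x + z))).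
{ intros f f' Hf z; evar_last.
  - apply (is_derive_comp f (fun z => x + z)); [apply Hf | auto_derive; [trivial | reflexivity]].
  - apply Rmult_1_l. }
assert (Htc : forall k : R -> R -> R,
  forall z t, continuous (fun p : R * R => k (fst p) (snd p)) (x + z, t) ->
  continuous (fun p : R * R => k (x + fst p) (snd p)) (z, t)).
{ intros k z t H.
  apply (continuous_comp_2 (fun p : R * R => x + fst p) snd k); [| apply continuous_snd | exact H].
  apply (continuous_plus (V := R_NormedModule)); [apply continuous_const | apply continuous_fst]. }
split; [| split; [| split; [| split; [| split; [| split]]]]].
- intros z t Ht; apply (Htr (fun y => u y t) (fun y => ux y t)); auto.
- intros z t Ht; apply (Htr (fun y => ux y t) (fun y => uxx y t)); auto.
- intros z t Ht; now apply Dt.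
- intros z t Ht; destruct (Hc (x + z) t Ht) as (C1 & _ & C2 & C3).
  split; [| split]; [now apply (Htc u) | now apply (Htc uxx) | now apply (Htc ut)].
- intros z t Ht; specialize (Heq (x + z) t Ht); lra.
- intros t Ht; destruct (HU t Ht) as [[HUc _] HUd].
  apply (weak_primitive_translate x (U t) (fun x => u x t)); auto.
  intros z; apply (ex_derive_continuous (fun y => u y t)); eexists; now apply Dx.
- intros t z Ht; destruct (HU t Ht) as [(HUc & HUl & _) _]; split.
  + apply (continuous_comp (fun z => x + z) (U t)); [| apply HUc].
    apply (continuous_plus (V := R_NormedModule)); [apply continuous_const | apply continuous_id].
  + now apply alex_norm_sup; [| apply HM].
Qed.

(* u x t = u(x,t); ux, uxx, ut its partial derivatives (continuous on
   R x (0,oo)); U t is the B_c-primitive of u(.,t); F is the B_c-primitive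
   of f in A_c. *)
Theorem theorem6p3 (u ux uxx ut : R -> R -> R) (U : R -> R -> R) (F : R -> R) :
  (forall x t, 0 < t -> is_derive (fun y => u y t) x (ux x t)) ->
  (forall x t, 0 < t -> is_derive (fun y => ux y t) x (uxx x t)) ->
  (forall x t, 0 < t -> is_derive (fun s => u x s) t (ut x t)) ->
  (forall x t, 0 < t ->
     continuous (fun p : R * R => u (fst p) (snd p)) (x, t) /\
     continuous (fun p : R * R => ux (fst p) (snd p)) (x, t) /\
     continuous (fun p : R * R => uxx (fst p) (snd p)) (x, t) /\
     continuous (fun p : R * R => ut (fst p) (snd p)) (x, t)) ->
  (forall x t, 0 < t -> ut x t - uxx x t = 0) ->
  (forall t, 0 < t -> Ac_primitive (fun x => u x t) (U t)) ->
  (exists M : R, forall t, 0 < t -> Rbar_le (alex_norm (U t)) (Finite M)) ->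
  in_Bc F ->
  filterlim (fun t => alex_norm (fun x => U t x - F x)) (at_right 0) (Rbar_locally (Finite 0)) ->
  forall x t, 0 < t -> u x t = conv_Theta F t x.
Proof.
intros Dx Dxx Dt Hc Heq HU [M HM] HF Hlim x t Ht.
assert (Hw := heat_flow_translate u ux uxx ut U M x Dx Dxx Dt Hc Heq HU HM).
destruct (in_Bc_bounded F HF) as [N [HN0 HN]].
assert (HFc : forall z, continuous (fun z => F (x + z)) z).
{ intros z; apply (continuous_comp (fun z => x + z) F); [| apply HF].
  apply (continuous_plus (V := R_NormedModule)); [apply continuous_const | apply continuous_id]. }
destruct (heat_symmetric_integral _ _ _ _ _ (fun z => F (x + z)) M N t Hw Ht HFc) as [A HA].
{ intros; apply HN. }
{ intros eps Heps.
  destruct (alex_norm_cvg_uniform U F) with (eps := eps) as [d [Hd0 Hd]]; auto.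
  - intros s Hs; now apply HU.
  - exists d; split; [assumption |]; intros s Hs z; now apply Hd. }
(* The integral is brought back from [z] to [y = x + z]. The decay constant [40 * N] combines the
   bound on [z ^ 2 * Theta_z] with that on [F]. *)
assert (HI : is_RInt_gen (fun y => F (x + (y - x)) * Theta_z t (y - x))
  (Rbar_locally m_infty) (Rbar_locally p_infty) (- u (x + 0) t)).
{ apply (is_RInt_gen_of_symmetric (fun z => F (x + z) * Theta_z t z) x A (40 * N)); auto.
  - intros z; apply (continuous_mult (K := R_AbsRing)); [apply HFc |].
    apply elem_continuous, elem_Theta_z.
  - intros z; destruct (Theta_bounds t z Ht) as (_ & B & _).
    rewrite pow2_abs in B; rewrite Rabs_mult.
    assert (K := HN (x + z)); assert (K' := Rabs_pos (F (x + z))).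
    assert (0 <= z ^ 2 * Rabs (Theta_z t z))
      by (apply Rmult_le_pos; [apply pow2_ge_0 | apply Rabs_pos]).
    replace (z ^ 2 * (Rabs (F (x + z)) * Rabs (Theta_z t z)))
      with (z ^ 2 * Rabs (Theta_z t z) * Rabs (F (x + z))) by ring.
    apply Rmult_le_compat; auto. }
rewrite Rplus_0_r in HI.
unfold conv_Theta, pair_Ac.
rewrite (is_lim_unique _ _ _ (is_lim_Theta_reflected t x Ht)).
(* [Theta_z] is odd in space, so the derivative of [xi => Theta t (x - xi)], namely
   [- Theta_z t (x - xi)], equals [Theta_z t (xi - x)]. The integral is thus [- u x t], and the
   minus sign in [pair_Ac] restores [u x t]. *)
assert (E : forall y, F (x + (y - x)) * Theta_z t (y - x)
  = F y * Derive (fun xi => Theta t (x - xi)) y).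
{ intros y; replace (x + (y - x)) with y by ring; f_equal; symmetry; apply is_derive_unique.
  evar_last.
  - apply (is_derive_comp (Theta t) (fun xi => x - xi)); [now apply is_derive_Theta |].
    auto_derive; [trivial | reflexivity].
  - unfold scal; simpl; unfold mult; simpl; unfold Theta_z, Theta.
    replace (- (x - y) ^ 2) with (- (y - x) ^ 2) by ring; field.
    assert (HP := PI_RGT_0); assert (H := sqrt_lt_R0 (4 * PI * t) ltac:(nra)); lra. }
rewrite <- (RInt_gen_ext_eq _ _ E) by (eexists; exact HI).
rewrite (is_RInt_gen_unique _ _ HI); simpl; ring.
Qed.
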